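(* Let $\mathcal{A}=(A_0,\ldots,A_{M-1})\in M_d(\mathbb{R})^M$. Suppose that each $A_i$ is non-negative with respect to a cone $K$ (that is, $A_iK\subseteq K$), and that $A:=\sum_i A_i$ is such that $\sum_{k=0}^{d-1}A^k$ maps $K\setminus\{0\}$ into the interior of $K$ (that is, $A$ is $K$-irreducible). Then there exists a $1$-Gibbs state for $\mathcal{A}$, denoted $\mu_{\mathcal{A}}$. Moreover: 1. $\mu_{\mathcal{A}}$ is ergodic and thus unique (it is the unique $1$-Gibbs state for $\mathcal{A}$), and $P(\mathcal{A},1)=\log\rho(A)$. 2. If there exists an $N$ such that $A^N$ maps $K\setminus\{0\}$ into the interior of $K$ (that is, $A$ is $K$-primitive), then (a) $\mu_{\mathcal{A}}$ is weak Bernoulli; (b) $\mu_{\mathcal{A}}$ has exponential decay of correlations for Hölder continuous functions. That is, for a fixed $\theta\in(0,1)$ there are constants $D$ and $\gamma\in(0,1)$ such that $$\left|\int f\cdot g\circ\sigma^n\,d\mu_{\mathcal{A}}-\int f\,d\mu_{\mathcal{A}}\int g\,d\mu_{\mathcal{A}}\right|\le D\,\|f\|_\theta\,\|g\|_\theta\,\gamma^n$$ for all $f,g\in\mathcal{H}_\theta$ and $n\ge 0$. In addition, the rate $\gamma$ is determined by $\theta$ and the eigenvalues of $A$.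
   Context: Let $\Sigma=\{0,\ldots,M-1\}$ and let $\sigma$ be the left shift on the two-sided full shift $\Sigma^{\mathbb{Z}}$. The cylinder is $[x_0\cdots x_{n-1}]=\{y\in\Sigma^{\mathbb{Z}}:y_i=x_i,\ 0\le i\le n-1\}$. $\rho$ denotes spectral radius. A subset $K\subseteq\mathbb{R}^d$ is called a cone if it is convex, $K\cap(-K)=\{0\}$, and $\lambda K=K$ for all $\lambda>0$. Matrix Gibbs state: a shift-invariant Borel probability measure $\mu$ on $\Sigma^{\mathbb{Z}}$ is a $1$-Gibbs state for $\mathcal{A}$ if there exist constants $C>0$ and $P$ with $$C^{-1}\mu([x_0\cdots x_{n-1}])\le e^{-nP}\|A_{x_0}\cdots A_{x_{n-1}}\|\le C\,\mu([x_0\cdots x_{n-1}])$$ for all $x\in\Sigma^{\mathbb{Z}}$, $n>0$. The constant $P$ is then uniquely determined, is called the pressure, and is denoted $P(\mathcal{A},1)$; one has $P(\mathcal{A},1)=\lim_{n\to\infty}\frac1n\log\sum_{x_0\cdots x_{n-1}}\|A_{x_0}\cdots A_{x_{n-1}}\|$. Weak Bernoulli: for partitions $\mathcal{Q},\mathcal{R}$ and $\varepsilon>0$, write $\mathcal{Q}\perp^{\varepsilon}\mathcal{R}$ if $\sum_{q\in\mathcal{Q},r\in\mathcal{R}}|\mu(q\cap r)-\mu(q)\mu(r)|<\varepsilon$. A partition $\mathcal{P}$ is weak Bernoulli if for every $\varepsilon>0$ there is $N'$ such that $\bigvee_{i=0}^{s-1}\sigma^{-i}\mathcal{P}\perp^{\varepsilon}\bigvee_{i=m}^{m+r-1}\sigma^{-i}\mathcal{P}$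 for all $r,s\ge 0$ and $m\ge s+N'$. The measure $\mu$ is weak Bernoulli if the standard partition $\mathcal{P}=\{[i]:0\le i\le M-1\}$ is weak Bernoulli. Hölder functions: $\mathrm{var}_n f=\sup\{|f(x)-f(y)|:x_i=y_i\text{ for all }|i|\le n-1\}$. For $\theta\in(0,1)$, $\mathcal{H}_\theta$ is the set of $f\in C(\Sigma^{\mathbb{Z}})$ for which there is a constant $c>0$ with $\mathrm{var}_n f\le c\,\theta^n$ for all $n$; the least such constant is denoted $|f|_\theta$, and $\|f\|_\theta=\|f\|_\infty+|f|_\theta$.
   Formalization: The cone K is additionally assumed to be closed and different from {0}, and the sum A of the matrices is assumed to be nonzero; without each of these conditions the claim as written is false. *)

(* Defs.v *)
From HB Require Import structures.
From mathcomp Require Import all_boot all_order all_algebra.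
From mathcomp Require Import all_classical all_reals all_analysis.
From mathcomp Require Import complex.

Set Implicit Arguments.
Unset Strict Implicit.
Unset Printing Implicit Defensive.

Import Order.TTheory GRing.Theory Num.Theory numFieldNormedType.Exports.

Local Open Scope classical_set_scope.
Local Open Scope ring_scope.

(* The two-sided full shift over the M.+1 symbols 0, ..., M, with the product
   of the discrete topologies and its Borel sigma-algebra. (The alphabet is
   never empty: measurable types are pointed.) *)
Definition fullshift (M : nat) : Type :=
  prod_topology (fun _ : int => discrete_topology 'I_M.+1).

HB.instance Definition _ M := Topological.on (fullshift M).
HB.instance Definition _ M := isPointed.Build (fullshift M) (fun=> ord0).
HB.instance Definition _ M :=
  Measurable.copy (fullshift M) (g_sigma_algebraType (@open (fullshift M))).

Section FullShift.
Variables (R : realType) (M : nat).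
Implicit Types (x y : fullshift M) (mu : probability (fullshift M) R).

Definition shift_map x : fullshift M := fun i : int => x (i + 1).

Definition cylinder x (n : nat) : set (fullshift M) :=
  [set y | forall i : nat, (i < n)%N -> y i%:Z = x i%:Z].

Definition shift_invariant mu : Prop :=
  forall B, measurable B -> mu (shift_map @^-1` B) = mu B.

Definition ergodic mu : Prop :=
  shift_invariant mu /\
  forall B, measurable B -> shift_map @^-1` B = B -> mu B = 0%E \/ mu B = 1%E.

(* Finite partitions are indexed families of cells. Empty cells are allowed;
   they do not contribute to the sum in [eps_indep]. *)
Definition eps_indep mu (eps : R) (I J : finType)
    (Q : I -> set (fullshift M)) (S : J -> set (fullshift M)) : Prop :=
  \sum_(q : I) \sum_(r : J)
    `|fine (mu (Q q `&` S r)) - fine (mu (Q q)) * fine (mu (S r))| < eps.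

(* The join of the sigma^{-i} P for m <= i < m + r, indexed by words w. *)
Definition join_partition (I : finType) (P : I -> set (fullshift M))
    (m r : nat) (w : {ffun 'I_r -> I}) : set (fullshift M) :=
  [set x | forall k : 'I_r, (iter (m + k)%N shift_map @^-1` P (w k)) x].

Definition weak_bernoulli_partition mu (I : finType)
    (P : I -> set (fullshift M)) : Prop :=
  forall eps : R, 0 < eps -> exists N' : nat, forall r s m : nat,
    (s + N' <= m)%N ->
    eps_indep mu eps (@join_partition I P 0 s) (@join_partition I P m r).

Definition standard_partition (i : 'I_M.+1) : set (fullshift M) :=
  [set x | x 0 = i].

Definition weak_bernoulli mu : Prop :=
  weak_bernoulli_partition mu standard_partition.

Definition var_ (n : nat) (f : fullshift M -> R) : R :=
  sup [set t | exists x y, (forall i : int, (`|i| < n)%N -> x i = y i) /\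
                           t = `|f x - f y|].

Definition holder_bound (theta : R) (f : fullshift M -> R) (c : R) : Prop :=
  0 < c /\ forall n, var_ n f <= c * theta ^+ n.

Definition holder (theta : R) (f : fullshift M -> R) : Prop :=
  continuous f /\ exists c, holder_bound theta f c.

Definition holder_seminorm (theta : R) (f : fullshift M -> R) : R :=
  inf [set c | holder_bound theta f c].

Definition sup_norm (f : fullshift M -> R) : R := sup [set `|f x| | x in setT].

Definition holder_norm (theta : R) (f : fullshift M -> R) : R :=
  sup_norm f + holder_seminorm theta f.

Definition correlation mu (f g : fullshift M -> R) (n : nat) : R :=
  (\int[mu]_x (f x * g (iter n shift_map x))) -
  (\int[mu]_x f x) * (\int[mu]_x g x).

End FullShift.

Section Matrices.
Variables (R : realType) (d : nat).
Implicit Types (B : 'M[R]_d) (K : set 'cV[R]_d).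

(* A cone need not be closed here, and {0} is a cone; closedness and
   nontriviality are separate hypotheses where they are needed. *)
Definition is_cone K : Prop :=
  [/\ convex_set K,
      K `&` [set - v | v in K] = [set 0] &
      forall l : R, 0 < l -> [set l *: v | v in K] = K].

Definition cone_nonneg K B : Prop := forall v, K v -> K (B *m v).

Definition cone_positive K B : Prop :=
  forall v, K v -> v != 0 -> (K°) (B *m v).

Definition cone_irreducible K B : Prop :=
  cone_positive K (\sum_(k < d) B ^+ k).

Definition cone_primitive K B : Prop := exists N : nat, cone_positive K (B ^+ N).

Definition spectrum B : set R[i] :=
  [set z | eigenvalue (map_mx (real_complex R) B) z].

Definition spectral_radius B : R :=
  sup [set ComplexField.Normc.normc z | z in spectrum B].

(* [`|_|] is the norm the library puts on matrices, the largest absolute value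
   of an entry; all norms on matrices being equivalent, another choice only
   changes C. *)
Definition gibbs_with_pressure (M : nat) (A : 'I_M.+1 -> 'M[R]_d)
    (mu : probability (fullshift M) R) (P : R) : Prop :=
  shift_invariant mu /\
  exists C : R, 0 < C /\
    forall (x : fullshift M) (n : nat), (0 < n)%N ->
      C^-1 * fine (mu (cylinder x n)) <=
        expR (- (n%:R * P)) * `|\prod_(i < n) A (x i%:Z)| /\
      expR (- (n%:R * P)) * `|\prod_(i < n) A (x i%:Z)| <=
        C * fine (mu (cylinder x n)).

Definition gibbs (M : nat) (A : 'I_M.+1 -> 'M[R]_d)
    (mu : probability (fullshift M) R) : Prop :=
  exists P : R, gibbs_with_pressure A mu P.

End Matrices.

(* Main.v *)
Require Import Defs.
From HB Require Import structures.
From mathcomp Require Import all_boot all_order all_algebra.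
From mathcomp Require Import all_classical all_reals all_analysis.
From mathcomp Require Import measurable_realfun complex zify lra ring.
Import Order.TTheory GRing.Theory Num.Theory numFieldNormedType.Exports.
Set Implicit Arguments.
Unset Strict Implicit.
Unset Printing Implicit Defensive.
Local Open Scope classical_set_scope.
Local Open Scope ring_scope.

(** Write [rho] for the spectral radius of the sum [A] of the matrices and
    [B = A / rho]. Everything rests on a Perron-Frobenius theorem for the cone
    ([perron_frobenius]): there are a right eigenvector [h] of [A] interior to
    [K] and a left eigenvector [u] positive on [K], with [u h = 1]. The weights
<<
      p(w) = u A_{w_0} ... A_{w_{n-1}} h / rho ^ n
>>
    are then consistent under adding a letter at either end, because [h] and
    [u] are fixed by [B]; so they are the cylinder masses of a shift-invariant
    probability measure ([word_measure]). Since [h] is interior and [u] is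
    positive, a [K]-non-negative matrix [X] has norm comparable to [u X h]
    ([cone_nonneg_bounds]), which is exactly the Gibbs property with pressure
    [ln rho].

    Summing over the words that fill a gap of length [g] replaces a product of
    letters by [B ^ g] ([matrix_measure_gap]). Hence correlations of cylinders
    are governed by the difference between [B ^ g] and the projection
    [Q = h u]. Two estimates on this difference give the two halves of the
    theorem.

    - In the irreducible case the sums of [B ^ i - Q] over [i < n] stay bounded
      ([mean_ergodic]). Ergodic averages of cylinder indicators then converge in
      mean square under the constructed measure, hence also under every
      invariant measure that it dominates on cylinders
      ([dominated_proportional]). Restricting the measure to an invariant set
      yields ergodicity; comparing it with another Gibbs measure, which must have
      the same pressure and therefore comparable cylinder masses, yields
      uniqueness.

    - In the primitive case [B ^ g - Q] decays exponentially. A minorisation of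
      some power of [B] by [Q] keeps the eigenvalues of [A] other than [rho] in a
      smaller disc, and the Cayley-Hamilton theorem converts bounds on
      eigenvalues into bounds on powers, with a rate read off the spectrum
      ([mixing_rate]). The measure is then psi-mixing, the error being relative
      to the product of the two masses. Summing over words gives the weak
      Bernoulli property, and truncating Hölder functions to finite windows
      gives exponential decay of correlations. *)

(** * Norms of matrices *)

Section MatrixNorm.
Context {R : realType}.

Lemma entry_le_norm m n (X : 'M[R]_(m, n)) i j : `|X i j| <= `|X|.
Proof.
rewrite [leRHS]/Num.Def.normr /= mx_normrE.
by apply: (le_bigmax_cond _ (fun ij : 'I_m * 'I_n => `|X ij.1 ij.2|)
  (j := (i, j))).
Qed.

Lemma norm_le_entry m n (X : 'M[R]_(m, n)) (c : R) :
  0 <= c -> (forall i j, `|X i j| <= c) -> `|X| <= c.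
Proof.
move=> c0 Xc; rewrite [leLHS]/Num.Def.normr /= mx_normrE.
by apply/bigmax_leP; split => // -[i j] _; exact: Xc.
Qed.

Lemma norm_mulmx m n p (X : 'M[R]_(m, n)) (Y : 'M[R]_(n, p)) :
  `|X *m Y| <= n%:R * `|X| * `|Y|.
Proof.
apply: norm_le_entry => [|i j]; first by rewrite !mulr_ge0.
rewrite mxE (le_trans (ler_norm_sum _ _ _))//.
rewrite -mulrA mulr_natl -[X in _ *+ X]card_ord -sumr_const ler_sum// => k _.
by rewrite normrM ler_pM// entry_le_norm.
Qed.

Lemma lipschitz_cts m n m' n' (f : 'M[R]_(m, n) -> 'M[R]_(m', n')) (c : R) :
  (forall x y, `|f x - f y| <= c * `|x - y|) -> continuous f.
Proof.
move=> fc x; apply/(@cvgrPdist_le _ _ _ (nbhs x)) => e e0.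
have c0 : 0 < `|c| + 1 by rewrite ltr_pwDr.
apply/(@nbhs_normP _ _ x); exists (e / (`|c| + 1)); first exact: divr_gt0.
move=> y /= /ltW; rewrite ler_pdivlMr// => /(le_trans _); apply.
rewrite (le_trans (fc _ _))// mulrC ler_wpM2l//.
by rewrite (le_trans (ler_norm c))// lerDl.
Qed.

Lemma mulmx_cts m n p (X : 'M[R]_(m, n)) :
  continuous (fun x : 'M[R]_(n, p) => X *m x).
Proof.
by apply: (@lipschitz_cts _ _ _ _ _ (n%:R * `|X|)) => x y;
  rewrite -mulmxBr norm_mulmx.
Qed.

Lemma coord_cts m n i j : continuous (fun x : 'M[R]_(m, n) => x i j).
Proof.
move=> x; apply/(@cvgrPdist_le _ _ _ (nbhs x)) => e e0.
apply/(@nbhs_normP _ _ x); exists e => // y /= /ltW; apply: le_trans.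
by have := entry_le_norm (x - y) i j; rewrite !mxE.
Qed.

(** Transposition is an isometry onto row vectors, where Heine-Borel is known. *)
Lemma cV_bounded_closed_compact n (S : set 'cV[R]_n) :
  bounded_set S -> closed S -> compact S.
Proof.
move=> bS cS.
have trE (p q : nat) (x : 'M[R]_(p, q)) : `|x^T| = `|x|.
  apply/eqP; rewrite eq_le; apply/andP; split;
    apply: norm_le_entry => // i j; rewrite ?mxE ?entry_le_norm//.
  by have := entry_le_norm x^T j i; rewrite mxE.
have trc p q : continuous (fun x : 'M[R]_(p, q) => x^T).
  by apply: (@lipschitz_cts _ _ _ _ _ 1) => x y; rewrite -linearB/= trE mul1r.
have -> : S = (fun x : 'rV[R]_n => x^T) @` ((fun x : 'rV[R]_n => x^T) @^-1` S).
  apply/seteqP; split => [x Sx|x [y /= Sy <-]//].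
  by exists x^T; rewrite /= trmxK.
apply: continuous_compact; first exact/continuous_subspaceT/trc.
apply: bounded_closed_compact.
  case: bS => M [Mr MS]; exists M; split=> // N /MS NS x /= /NS.
  by move=> h; rewrite -[leLHS](trE _ _ x); exact: h.
by move/continuous_closedP: (trc 1%N n); apply.
Qed.

End MatrixNorm.

Lemma exp_scale_mx {F : comNzRingType} d (a : F) (X : 'M[F]_d) n :
  (a *: X) ^+ n = a ^+ n *: X ^+ n.
Proof.
elim: n => [|n ih]; first by rewrite !expr0 scale1r.
by rewrite !exprS ih -!mulmxE -scalemxAl -scalemxAr scalerA.
Qed.

(** * Closed cones *)

Section Cone.
Context {R : realType} {d : nat} (K : set 'cV[R]_d).
Hypotheses (coneK : is_cone K) (closedK : closed K).

Lemma cone0 : K 0.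
Proof. by case: coneK => _ + _ => /seteqP[_ /(_ 0 erefl)[]]. Qed.

Lemma coneZ (l : R) x : 0 <= l -> K x -> K (l *: x).
Proof.
rewrite le_eqVlt => /predU1P[<- _|l0 Kx]; first by rewrite scale0r; exact: cone0.
by case: coneK => _ _ /(_ _ l0) <-; exists x.
Qed.

Lemma coneD x y : K x -> K y -> K (x + y).
Proof.
move=> Kx Ky; have h0 : 0 <= 2^-1 :> R by [].
have h1 : 2^-1 <= 1 :> R by rewrite invf_le1// ler1n.
case: coneK => /(_ x y (Itv01 h0 h1)) + _ _; rewrite !inE => /(_ Kx Ky).
rewrite /conv /= => /(@coneZ 2); rewrite scalerDr !scalerA.
by rewrite mulrBr mulr1 divff// !scale1r -[2 - 1]/(1 + 1 - 1) addrK scale1r; apply.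
Qed.

Lemma cone_sum (I : Type) (s : seq I) (P : pred I) (F : I -> 'cV[R]_d) :
  (forall i, P i -> K (F i)) -> K (\sum_(i <- s | P i) F i).
Proof. by move=> KF; elim/big_ind : _ => //; [exact: cone0|exact: coneD]. Qed.

Lemma cone_pointed x : K x -> K (- x) -> x = 0.
Proof.
move=> Kx Knx; case: coneK => _ /seteqP[/(_ x) + _] _; apply; split=> //.
by exists (- x) => //; rewrite opprK.
Qed.

(** Interior points, by an explicit radius: the estimates below use the radius
    and not the topology. *)
Definition cone_inner (x : 'cV[R]_d) : Prop :=
  exists2 e : R, 0 < e & forall v : 'cV[R]_d, `|v| <= e -> K (x + v).

Lemma interior_cone_inner (x : 'cV[R]_d) : (K°) x -> cone_inner x.
Proof.
move=> /nbhs_ballP[e /= e0 xeK]; exists (e / 2); first exact: divr_gt0.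
move=> v ve; apply: xeK; rewrite -ball_normE /= opprD addrA subrr sub0r normrN.
by rewrite (le_lt_trans ve)// ltr_pdivrMr// ltr_pMr// ltr1n.
Qed.

Lemma cone_nonnegM X Y : cone_nonneg K X -> cone_nonneg K Y ->
  cone_nonneg K (X *m Y).
Proof. by move=> KX KY v Kv; rewrite -mulmxA; exact/KX/KY. Qed.

Lemma cone_nonnegX X n : cone_nonneg K X -> cone_nonneg K (X ^+ n).
Proof.
move=> KX; elim: n => [v Kv|n ih]; first by rewrite expr0 mul1mx.
by rewrite exprS; exact: cone_nonnegM.
Qed.

Lemma cone_nonnegZ (l : R) X : 0 <= l -> cone_nonneg K X ->
  cone_nonneg K (l *: X).
Proof. by move=> l0 KX v Kv; rewrite -scalemxAl; exact/coneZ/KX. Qed.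

Lemma closed_cone_sphere : closed (K `&` [set x | `|x| = 1]).
Proof.
apply: closedI => //; have /continuous_closedP := @norm_continuous R 'cV[R]_d.
by move=> /(_ [set 1]); apply; exact: closed_eq.
Qed.

Lemma compact_cone_sphere : compact (K `&` [set x | `|x| = 1]).
Proof.
apply: cV_bounded_closed_compact; last exact: closed_cone_sphere.
exists 1; split => // N N1 x [_ /= ->]; exact: ltW.
Qed.

(** A closed pointed cone is normal: cancellation between two of its vectors
    is bounded, since a unit vector of the cone keeps a positive distance to
    the opposite cone. *)
Lemma cone_normal :
  exists2 N : R, 0 < N & forall x y, K x -> K y -> `|x| <= N * `|x + y|.
Proof.
pose S := (K `&` [set x | `|x| = 1]) `*` (K `&` [set y | `|y| <= 2]).
have cS : compact S.
  apply: compact_setX; first exact: compact_cone_sphere.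
  apply: cV_bounded_closed_compact.
    by exists 2; split => // N N1 x [_ /= x2]; apply: le_trans x2 (ltW N1).
  apply: closedI => //.
  have /continuous_closedP := @norm_continuous R 'cV[R]_d.
  by move=> /(_ [set x | x <= 2]); apply; exact: closed_le.
have [c c0 Sc] : exists2 c : R, 0 < c & forall x y, S (x, y) -> c <= `|x + y|.
  have [S0|/set0P/negP] := pselect (S !=set0); last first.
    rewrite negbK => /eqP S0; exists 1 => // x y; by rewrite S0.
  have [|[x y]] := @compact_EVT_min _ R (fun z => `|z.1 + z.2|) S S0 cS.
    apply: continuous_subspaceT => z; apply: cvg_norm.
    by apply: cvgD; [exact: cvg_fst|exact: cvg_snd].
  rewrite inE => -[[/= Kx x1] [/= Ky _]] Smin.
  exists `|x + y|; last by move=> x' y' S'; apply: (Smin (x', y')); rewrite inE.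
  rewrite normr_gt0; apply/eqP => /eqP; rewrite addr_eq0 => /eqP xy.
  move: x1; rewrite [x]cone_pointed ?normr0//; last by rewrite xy opprK.
  by move/eqP; rewrite eq_sym oner_eq0.
exists (Num.max 1 c^-1); first by rewrite lt_max ltr01.
move=> x y Kx Ky; have [->|x0] := eqVneq x 0; first by rewrite normr0 mulr_ge0// le_max ler01.
have nx0 : 0 < `|x| by rewrite normr_gt0.
wlog x1 : x y Kx Ky {x0 nx0} / `|x| = 1.
  move=> /(_ (`|x|^-1 *: x) (`|x|^-1 *: y)); rewrite -scalerDr !normrZ.
  rewrite !ger0_norm ?invr_ge0// mulVf ?gt_eqF//.
  move=> /(_ (coneZ _ Kx) (coneZ _ Ky)); rewrite !invr_ge0 => /(_ _ _ erefl).
  by rewrite mulrCA mulrC ler_pdivlMr// mul1r; apply.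
have m0 : 0 <= Num.max 1 c^-1 by rewrite le_max ler01.
have [y2|/ltW y2] := leP `|y| 2.
  have := Sc x y (conj (conj Kx x1) (conj Ky y2)) => cxy.
  rewrite x1 -(mulVf (lt0r_neq0 c0)) ler_pM// ?invr_ge0 ?(ltW c0)//.
  by rewrite le_max lexx orbT.
(* A vector of norm at least 2 cannot come closer than 1 to a unit vector. *)
have xy1 : 1 <= `|x + y|.
  by have := lerB_normD y x; rewrite [y + x]addrC x1; lra.
by rewrite x1 -[leLHS]mulr1 ler_pM// le_max lexx.
Qed.

(** Every vector is a difference of two vectors of the cone that are
    comparable to the interior point [h], so a non-negative matrix is
    controlled by its value at [h]. *)
Lemma cone_nonneg_norm (h : 'cV[R]_d) : cone_inner h ->
  exists2 C : R, 0 < C & forall X, cone_nonneg K X -> `|X| <= C * `|X *m h|.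
Proof.
move=> [e e0 he]; have [N N0 KN] := cone_normal.
have Xv X (v : 'cV[R]_d) : cone_nonneg K X -> `|v| <= e -> `|X *m v| <= (2 * N + 1) * `|X *m h|.
  move=> KX ve; have Kp : K (X *m h + X *m v) by rewrite -mulmxDr; exact/KX/he.
  have Km : K (X *m h - X *m v).
    by rewrite -mulmxBr; apply/KX/he; rewrite normrN.
  have := KN _ _ Kp Km; rewrite addrACA subrr addr0 -mulr2n normrMn.
  rewrite -[`|_| *+ 2]mulr_natl mulrA [N * _]mulrC => XN.
  rewrite -[X *m v](addKr (X *m h)) (le_trans (ler_normD _ _))// normrN.
  by rewrite addrC mulrDl mul1r lerD2r.
exists ((2 * N + 1) / e) => [|X KX]; first by rewrite divr_gt0// addr_gt0// mulr_gt0.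
apply: norm_le_entry => [|i j].
  by rewrite !mulr_ge0 ?invr_ge0 ?(ltW e0)// addr_ge0// mulr_ge0// ltW.
have := Xv X (e *: delta_mx j ord0) KX.
rewrite -scalemxAr -colE normrZ (gtr0_norm e0).
have d1 : `|delta_mx j ord0 : 'cV[R]_d| <= 1.
  by apply: norm_le_entry => // k l; rewrite mxE; case: andP; rewrite ?normr1 ?normr0.
move=> /(_ (ler_piMr (ltW e0) d1)) /(le_trans _) XE.
rewrite mulrAC ler_pdivlMr// mulrC; apply: XE.
have := entry_le_norm (col j X) i ord0; rewrite mxE => Xij.
by rewrite normrZ (gtr0_norm e0) ler_pM2l.
Qed.

Lemma cone_innerK x : cone_inner x -> K x.
Proof.
case=> e e0 xe; rewrite -[x]addr0; apply: xe.
by rewrite [X in X <= _](normr0 'cV[R]_d) ltW.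
Qed.

Lemma cone_innerZ (l : R) x : 0 < l -> cone_inner x -> cone_inner (l *: x).
Proof.
move=> l0 [e e0 xe]; exists (l * e) => [|v ve]; first exact: mulr_gt0.
rewrite -[v](scalerKV (lt0r_neq0 l0)) -scalerDr; apply/coneZ/xe; first exact: ltW.
by rewrite normrZ gtr0_norm ?invr_gt0// mulrC ler_pdivrMr// mulrC.
Qed.

(** If [0] were interior the cone would contain a line; the vector [y] only
    serves to exclude dimension zero. *)
Lemma cone_inner_neq0 (x y : 'cV[R]_d) : y != 0 -> cone_inner x -> x != 0.
Proof.
move=> y0 [e e0 xe]; apply/eqP => x0; move: xe; rewrite x0 => ye.
have ny0 : 0 < `|y| by rewrite normr_gt0.
have nE (s : R) : `|s| = 1 -> K (s *: ((e / `|y|) *: y)).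
  move=> s1; rewrite -[_ *: _]add0r; apply: ye.
  rewrite scalerA normrZ normrM s1 mul1r ger0_norm ?divr_ge0// ?(ltW e0)//.
  by rewrite divfK// gt_eqF.
move: y0; have := nE 1 (normr1 R); have := nE (-1) (normrN1 R).
rewrite scale1r scaleN1r => Kn Kp; have /eqP := cone_pointed Kp Kn.
by rewrite scaler_eq0 mulf_eq0 invr_eq0 !gt_eqF//= => ->.
Qed.

(** * The Perron eigenvector *)

Section Irreducible.
Variable A : 'M[R]_d.
Hypotheses (KA : cone_nonneg K A) (irrA : cone_irreducible K A).
Hypotheses (K_neq0 : K <> [set 0]) (A_neq0 : A != 0).

Let S := \sum_(k < d) A ^+ k.

Lemma exp_eigen (l : R) (X : 'M[R]_d) (x : 'cV[R]_d) k :
  X *m x = l *: x -> X ^+ k *m x = l ^+ k *: x.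
Proof.
move=> Xx; elim: k => [|k ih]; first by rewrite !expr0 mul1mx scale1r.
by rewrite !exprS -mulmxA ih -scalemxAr Xx scalerA mulrC.
Qed.

(** A non-negative eigenvector is a positive multiple of its image under the
    positive matrix [S], hence an interior point. *)
Lemma eigen_inner (l : R) x : 0 <= l -> K x -> x != 0 -> A *m x = l *: x ->
  cone_inner x.
Proof.
move=> l0 Kx x0 Ax; pose s := \sum_(k < d) l ^+ k.
have Sx : S *m x = s *: x.
  by rewrite mulmx_suml scaler_suml; apply: eq_bigr => k _; exact: exp_eigen.
have d0 : (0 < d)%N.
  case: (posnP d) => // d0; case/eqP: x0; apply/matrixP => i.
  by exfalso; have := leq_ltn_trans (leq0n i) (ltn_ord i); rewrite lt0n d0.
have s0 : 0 < s.
  rewrite /s (bigD1 (Ordinal d0))//= expr0 ltr_pwDl// sumr_ge0// => k _.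
  exact: exprn_ge0.
rewrite -[x](scalerK (lt0r_neq0 s0)) -Sx; apply: cone_innerZ; first by rewrite invr_gt0.
exact/interior_cone_inner/irrA.
Qed.

Lemma cone_unit_exists : exists x, K x /\ `|x| = 1.
Proof.
have [x [Kx x0]] : exists x, K x /\ x != 0.
  apply: contrapT => h; apply: K_neq0; apply/seteqP; split => [x Kx|_ ->]; last exact: cone0.
  by apply: contrapT => /eqP x0; apply: h; exists x.
exists (`|x|^-1 *: x); split; first exact: coneZ.
by rewrite normrZ normrV ?unitfE ?normr_eq0// normr_id mulVf// normr_eq0.
Qed.

(** The largest [l] such that [A x - l x] lies in [K] for some unit vector [x]
    of [K] is an eigenvalue: otherwise applying [S] to the non-zero excess
    [A x - l x] gives an interior point, leaving room to increase [l]. It is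
    positive because a non-negative matrix that kills an interior point is
    zero. *)
Lemma perron_vector : exists (rho : R) (h : 'cV[R]_d),
  [/\ 0 < rho, cone_inner h, h != 0 & A *m h = rho *: h].
Proof.
have [N N0 KN] := cone_normal.
(* Normality bounds [l]: both [l x] and [A x - l x] lie in [K]. *)
pose L := N * (d%:R * `|A|).
pose T := [set p : R * 'cV[R]_d | [/\ 0 <= p.1, K p.2, `|p.2| = 1 &
  K (A *m p.2 - p.1 *: p.2)]].
have TL p : T p -> p.1 <= L.
  case: p => l x [/= l0 Kx x1 KAx].
  have := KN _ _ (coneZ l0 Kx) KAx; rewrite addrC subrK normrZ x1 mulr1 ger0_norm//.
  move=> /le_trans; apply; rewrite ler_wpM2l// ?(ltW N0)//.
  by have := norm_mulmx A x; rewrite x1 mulr1.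
have cT : compact T.
  have cI : compact (`[0, L]%classic : set R) by exact: segment_compact.
  apply: subclosed_compact (compact_setX cI compact_cone_sphere) _; last first.
    move=> p Tp; case: (Tp) => p1 Kp2 p2 _.
    by split => //=; rewrite in_itv/= p1 TL.
  rewrite (_ : T = fst @^-1` [set l | 0 <= l] `&` (snd @^-1` (K `&` [set x | `|x| = 1]) `&`
     (fun p => A *m p.2 - p.1 *: p.2) @^-1` K)); last first.
    by apply/seteqP; split => [p [? ? ? ?]|p [? [[? ?] ?]]]; do ?split.
  have c1 : continuous (@fst R 'cV[R]_d) by move=> p; exact: cvg_fst.
  have c2 : continuous (@snd R 'cV[R]_d) by move=> p; exact: cvg_snd.
  apply: closedI; first by move/continuous_closedP: c1; apply; exact: closed_ge.
  apply: closedI.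
    move/continuous_closedP: c2; apply; exact: closed_cone_sphere.
  apply: preimage_closed => // p _.
  apply: cvgB; last by apply: cvgZ; [exact: c1|exact: c2].
  exact: (cvg_comp _ _ (c2 p) (@mulmx_cts _ _ _ _ A p.2)).
have T0 : T !=set0.
  have [x [Kx x1]] := cone_unit_exists.
  by exists (0, x); split => //=; rewrite scale0r subr0; exact: KA.
have [|[rho x]] := @compact_EVT_max _ R (fun z => z.1) T T0 cT.
  by apply: continuous_subspaceT => p; exact: cvg_fst.
rewrite inE => -[/= rho0 Kx x1 Ky] rhomax.
have x0 : x != 0 by rewrite -normr_eq0 x1 oner_eq0.
have Ax : A *m x = rho *: x.
  apply/eqP; rewrite -subr_eq0; apply/negPn/negP => y0.
  have [e e0 ye] := interior_cone_inner (irrA Ky y0).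
  have zin := interior_cone_inner (irrA Kx x0).
  have nz : 0 < `|S *m x| by rewrite normr_gt0; exact: cone_inner_neq0 x0 zin.
  have AS : A *m S = S *m A by apply: commr_sum => k _; exact: commrX.
  have : T (rho + e / `|S *m x|, `|S *m x|^-1 *: (S *m x)).
    split => /=.
    - by rewrite addr_ge0// divr_ge0// ltW.
    - by apply: coneZ; [rewrite invr_ge0|exact: cone_innerK].
    - by rewrite normrZ gtr0_norm ?invr_gt0// mulVf// gt_eqF.
    - rewrite -scalemxAr scalerA mulrC -scalerA -scalerBr; apply: coneZ.
        by rewrite invr_ge0.
      rewrite mulmxA AS -mulmxA scalerDl opprD addrA scalemxAr -mulmxBr.
      apply: ye; rewrite normrN normrZ ger0_norm ?divr_ge0// ?(ltW e0)//.
      by rewrite divfK// gt_eqF.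
  move=> Tr; have := rhomax _ (mem_set Tr).
  by rewrite /= gerDl leNgt divr_gt0.
have xin := eigen_inner rho0 Kx x0 Ax.
exists rho, x; split => //; rewrite lt_neqAle rho0 andbT eq_sym.
apply: contra A_neq0 => /eqP r0; have [C C0 KC] := cone_nonneg_norm xin.
by have := KC A KA; rewrite Ax r0 scale0r normr0 mulr0 normr_le0.
Qed.

End Irreducible.

(** * Fixed vectors and the mean ergodic theorem *)

(** From here on the matrix is normalised to have eigenvalue 1 at [h], and
    irreducibility is used only through two consequences: non-negative fixed
    vectors are interior ([fix_inner]) and, later, some matrix having [u] as a
    left eigenvector is positive. *)
Section FixedPoint.
Variables (B : 'M[R]_d) (h : 'cV[R]_d).
Hypotheses (KB : cone_nonneg K B) (hin : cone_inner h) (h_neq0 : h != 0).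
Hypothesis Bh : B *m h = h.
Hypothesis fix_inner : forall x, K x -> x != 0 -> B *m x = x -> cone_inner x.

Let Kh : K h. Proof. exact: cone_innerK. Qed.

Lemma fixX n : B ^+ n *m h = h.
Proof. by elim: n => [|n ih]; rewrite ?expr0 ?mul1mx// exprS -mulmxA ih. Qed.

(** All powers take the same value at the interior point [h]. *)
Lemma power_bounded : exists2 C : R, 0 < C & forall n, `|B ^+ n| <= C.
Proof.
have [C C0 KC] := cone_nonneg_norm hin.
exists (C * `|h|) => [|n]; first by rewrite mulr_gt0 ?normr_gt0.
by have := KC _ (cone_nonnegX n KB); rewrite fixX.
Qed.

(** For the least [s] with [s h + x] in [K], the fixed vector [s h + x] is not
    interior, so it is zero. *)
Lemma fix_line (x : 'cV[R]_d) : B *m x = x -> exists a : R, x = a *: h.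
Proof.
move=> Bx; have [N N0 KN] := cone_normal; have [e e0 he] := hin.
have nh : 0 < `|h| by rewrite normr_gt0.
(* [U] is large enough by the ball around [h], [L] small enough by normality. *)
pose U := `|x| / e; pose L := - (N * `|x| / `|h|).
pose T := `[L, U]%classic `&` [set s : R | K (s *: h + x)].
have lowL s : K (s *: h + x) -> L <= s.
  move=> Ks; have [s0|s0] := leP 0 s.
    by rewrite (le_trans _ s0)// oppr_le0 !mulr_ge0 ?invr_ge0// ltW.
  have Ksh : K (- s *: h) by apply: coneZ => //; rewrite oppr_ge0 ltW.
  have := KN _ _ Ksh Ks; rewrite addrA scaleNr addNr add0r normrN normrZ.
  by rewrite ltr0_norm// -ler_pdivlMr// /L lerNl.
have cT : compact T.
  apply: compact_closedI; first exact: segment_compact.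
  apply: preimage_closed => // s _.
  by apply: cvgD; [apply: cvgZl|exact: cvg_cst].
have TU : T U.
  have KU : K (U *: h + x).
    have [->|x0] := eqVneq x 0.
      by rewrite addr0; apply: coneZ => //; rewrite divr_ge0// ltW.
    have U0 : 0 < U by rewrite divr_gt0// normr_gt0.
    rewrite -[x](scalerKV (lt0r_neq0 U0)) -scalerDr; apply: coneZ; first exact: ltW.
    apply: he; rewrite normrZ gtr0_norm ?invr_gt0// /U invf_div.
    by rewrite divfK// normr_eq0.
  by split => //=; rewrite in_itv/= lowL//=.
have [s sT smin] := @compact_EVT_min _ R id T (ex_intro _ U TU) cT
  (@continuous_subspaceT _ _ _ _ (fun s => cvg_id)).
have {sT}[/= /[!in_itv]/= /andP[Ls sU] Ks] : T s by rewrite inE in sT.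
have [z0|z0] := eqVneq (s *: h + x) 0.
  by exists (- s); rewrite scaleNr; apply/eqP; rewrite -addr_eq0 addrC z0.
have [e1 e10 ze] : cone_inner (s *: h + x).
  by apply: fix_inner => //; rewrite mulmxDr -scalemxAr Bh Bx.
pose t := e1 / `|h|; have t0 : 0 < t by rewrite divr_gt0.
have Kt : K ((s - t) *: h + x).
  rewrite scalerBl addrAC; apply: ze.
  by rewrite normrN normrZ gtr0_norm// divfK// gt_eqF.
have : s - t \in T.
  by rewrite inE; split => //=; rewrite in_itv/= lowL//= lerBlDr ler_wpDr// ltW.
by move/smin; rewrite lerBrDl gerDr leNgt t0.
Qed.

Lemma left_fix_exists : exists2 u : 'rV[R]_d, u != 0 & u *m B = u.
Proof.
have /det0P[u u0 uB] : \det (B - 1) == 0.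
  rewrite -det_tr; apply/det0P; exists h^T; first by rewrite trmx_eq0.
  by rewrite -trmx_mul mulmxBl Bh mul1mx subrr trmx0.
by exists u => //; apply/eqP; rewrite -subr_eq0 -{2}[u]mulmx1 -mulmxBr uB.
Qed.

(** Rank count: [B - 1] has corank at most one, so its column space is the
    whole annihilator of the fixed row vector [u]. *)
Lemma annihilator_range (u : 'rV[R]_d) p (X : 'M[R]_(d, p)) :
  u != 0 -> u *m B = u -> u *m X = 0 -> exists Z, X = (B - 1) *m Z.
Proof.
move=> u0 uB uX; pose C := (B - 1)^T.
have kerC : (kermx C <= h^T)%MS.
  apply/row_subP => i.
  have : B *m (row i (kermx C))^T = (row i (kermx C))^T.
    have : row i (kermx C) *m C = 0 by rewrite -row_mul mulmx_ker row0.
    move/(congr1 trmx); rewrite trmx_mul trmxK mulmxBl mul1mx trmx0.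
    by move/eqP; rewrite subr_eq0 => /eqP.
  by move/fix_line => [a /(congr1 trmx)]; rewrite trmxK linearZ /= => ->;
    exact: scalemx_sub.
have CU : (C <= kermx u^T)%MS.
  apply/sub_kermxP; rewrite /C -trmx_mul mulmxBr uB mulmx1 subrr.
  exact: trmx0.
have ru : \rank u^T = 1%N by rewrite mxrank_tr rank_rV u0.
have rC : (\rank (kermx u^T) <= \rank C)%N.
  rewrite mxrank_ker ru leq_subLR addnC -leq_subLR -mxrank_ker.
  by rewrite (leq_trans (mxrankS kerC))// rank_leq_row.
have UC : (kermx u^T <= C)%MS by have := mxrank_leqif_sup CU => -[le] <-; rewrite eqn_leq le rC.
have /submxP[Z XZ] : (X^T <= C)%MS.
  by apply: submx_trans UC; apply/sub_kermxP; rewrite -trmx_mul uX trmx0.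
by exists Z^T; apply: trmx_inj; rewrite XZ trmx_mul trmxK.
Qed.

Lemma telescope_fix n p (Z : 'M[R]_(d, p)) :
  \sum_(i < n) B ^+ i *m ((B - 1) *m Z) = (B ^+ n - 1) *m Z.
Proof.
elim: n => [|n ih]; first by rewrite big_ord0 expr0 subrr mul0mx.
rewrite big_ord_recr /= ih mulmxA -mulmxDl; congr (_ *m _).
by rewrite mulmxE mulrBr mulr1 -exprSr addrC addrA subrK.
Qed.

(** If the left fixed vector annihilated [h] then [h = (B - 1) z] and
    [B ^+ n z = z + n h] would be unbounded. *)
Lemma left_fix_normalised : exists2 u : 'rV[R]_d, u *m B = u & u *m h = 1.
Proof.
have [u u0 uB] := left_fix_exists.
have uh : (u *m h) 0 0 != 0.
  apply/negP => /eqP uh0; have uh : u *m h = 0.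
    by apply/matrixP => i j; rewrite !ord1 uh0 mxE.
  have [z hz] := annihilator_range u0 uB uh.
  have [C C0 BC] := power_bounded.
  have bd n : n%:R * `|h| <= d%:R * (C + `|1 : 'M[R]_d|) * `|z|.
    have : \sum_(i < n) B ^+ i *m h = (B ^+ n - 1) *m z by rewrite {1}hz telescope_fix.
    rewrite (eq_bigr (fun=> h)) => [|i _]; last exact: fixX.
    rewrite sumr_const card_ord => /(congr1 (@Num.norm _ _)); rewrite normrMn.
    rewrite mulr_natl => ->; rewrite (le_trans (norm_mulmx _ _))//.
    by rewrite ler_wpM2r// ler_wpM2l// (le_trans (ler_normB _ _))// lerD2r.
  have nh : 0 < `|h| by rewrite normr_gt0.
  have := bd (Num.truncn (d%:R * (C + `|1 : 'M[R]_d|) * `|z| / `|h|)).+1.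
  by rewrite -ler_pdivlMr// leNgt truncnS_gt.
exists (((u *m h) 0 0)^-1 *: u); first by rewrite -scalemxAl uB.
by rewrite -scalemxAl [u *m h]mx11_scalar scale_scalar_mx mxE mulVf.
Qed.

Section LeftVector.
Variable u : 'rV[R]_d.
Hypotheses (uB : u *m B = u) (uh : u *m h = 1).

Definition ergodic_proj : 'M[R]_d := h *m u.
Let Q := ergodic_proj.

Lemma left_fixX n : u *m B ^+ n = u.
Proof. by elim: n => [|n ih]; rewrite ?expr0 ?mulmx1// exprSr mulmxA ih. Qed.

Lemma mulBQ n : B ^+ n *m Q = Q. Proof. by rewrite mulmxA fixX. Qed.
Lemma mulQB n : Q *m B ^+ n = Q. Proof. by rewrite -mulmxA left_fixX. Qed.
Lemma mulQQ : Q *m Q = Q. Proof. by rewrite mulmxA -[h *m u *m h]mulmxA uh mulmx1. Qed.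

Let u_neq0 : u != 0.
Proof.
by apply/eqP => u0; have /matrixP/(_ 0 0)/eqP := uh; rewrite u0 mul0mx !mxE eq_sym oner_eq0.
Qed.

(** The mean ergodic theorem with its rate: [1 - Q] factors through [B - 1],
    so the deviations of the powers telescope. *)
Lemma mean_ergodic : exists2 C : R, 0 < C & forall n, `|\sum_(i < n) (B ^+ i - Q)| <= C.
Proof.
have [Z QZ] : exists Z, 1 - Q = (B - 1) *m Z.
  apply: (annihilator_range u_neq0 uB).
  by rewrite mulmxBr mulmx1 mulmxA uh mul1mx subrr.
have [C C0 BC] := power_bounded.
exists (d%:R * (C + `|1 : 'M[R]_d|) * `|Z| + 1) => [|n].
  by rewrite ltr_wpDl// !mulr_ge0// addr_ge0// ltW.
have -> : \sum_(i < n) (B ^+ i - Q) = (B ^+ n - 1) *m Z.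
  rewrite -telescope_fix; apply: eq_bigr => i _.
  by rewrite -QZ mulmxBr mulmx1 mulBQ.
rewrite (le_trans (norm_mulmx _ _))// ler_wpDr//.
by rewrite ler_wpM2r// ler_wpM2l// (le_trans (ler_normB _ _))// lerD2r.
Qed.

(** The sum of [B ^ i k] over [i < n] lies in [K] and equals [n (u k) h] up to a
    bounded error, which [h] absorbs as an interior point; were [u k] negative,
    [- h] would lie in [K]. *)
Lemma left_fix_ge0 k : K k -> 0 <= (u *m k) 0 0.
Proof.
move=> Kk; rewrite leNgt; apply/negP => uk.
have [C C0 EC] := mean_ergodic; have [e e0 he] := hin.
pose a := - (u *m k) 0 0; have a0 : 0 < a by rewrite oppr_gt0.
pose n := (Num.truncn (d%:R * C * `|k| / (a / 2 * e))).+1.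
pose y := \sum_(i < n) B ^+ i *m k.
have Ky : K y by apply: cone_sum => i _; exact: (cone_nonnegX i KB).
pose r := (\sum_(i < n) (B ^+ i - Q)) *m k.
have yE : y = r - (n%:R * a) *: h.
  rewrite /r mulmx_suml (eq_bigr (fun i : 'I_n => B ^+ i *m k + a *: h)).
    rewrite big_split/= sumr_const card_ord -scaler_nat scalerA addrK.
    by [].
  move=> i _; rewrite mulmxBl -mulmxA [u *m k]mx11_scalar mul_mx_scalar.
  by rewrite /a scaleNr.
have nr : `|r| <= d%:R * C * `|k|.
  by rewrite (le_trans (norm_mulmx _ _))// ler_wpM2r// ler_wpM2l.
have ae : 0 < a / 2 * e by rewrite mulr_gt0// divr_gt0.
have na0 : 0 < n%:R * (a / 2) by rewrite mulr_gt0// divr_gt0.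
have Kr : K ((n%:R * (a / 2)) *: h - r).
  rewrite -[r](scalerKV (lt0r_neq0 na0)) -scalerBr; apply: coneZ; first exact: ltW.
  apply: he; rewrite normrN normrZ gtr0_norm ?invr_gt0// mulrC ler_pdivrMr//.
  rewrite (le_trans nr)// mulrCA [e * _]mulrC -ler_pdivrMr//.
  by rewrite ltW// truncnS_gt.
have Kmh : K (- ((n%:R * (a / 2)) *: h)).
  suff -> : - ((n%:R * (a / 2)) *: h) = y + ((n%:R * (a / 2)) *: h - r) by exact: coneD.
  have -> : y = r - (n%:R * (a / 2)) *: h - (n%:R * (a / 2)) *: h.
    rewrite yE -addrA -opprD -scalerDl; congr (_ - _ *: _).
    by rewrite -mulrDr -splitr.
  by rewrite addrA subrK addrAC subrr add0r.
have /eqP := cone_pointed (coneZ (ltW na0) Kh) Kmh.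
by rewrite scaler_eq0 (negPf h_neq0) orbF gt_eqF.
Qed.

Lemma left_fix_inner k : cone_inner k -> 0 < (u *m k) 0 0.
Proof.
case=> e e0 ke; have nh : 0 < `|h| by rewrite normr_gt0.
have : 0 <= (u *m (k - (e / `|h|) *: h)) 0 0.
  apply/left_fix_ge0/ke; rewrite normrN normrZ gtr0_norm ?divr_gt0//.
  by rewrite divfK// gt_eqF.
rewrite mulmxBr -scalemxAr uh !mxE mulr1 subr_ge0; apply: lt_le_trans.
by rewrite divr_gt0.
Qed.

(** [S] stands for the sum of the powers of [A] in the definition of
    irreducibility. *)
Section Positive.
Variables (S : 'M[R]_d) (s : R).
Hypotheses (S_pos : forall k, K k -> k != 0 -> cone_inner (S *m k)).
Hypothesis uS : u *m S = s *: u.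

Lemma left_fix_gt0 k : K k -> k != 0 -> 0 < (u *m k) 0 0.
Proof.
move=> Kk k0; rewrite lt_neqAle left_fix_ge0// andbT eq_sym.
apply/eqP => uk0; have := left_fix_inner (S_pos Kk k0).
by rewrite mulmxA uS -scalemxAl mxE uk0 mulr0 ltxx.
Qed.

Lemma left_fix_norm : exists2 c : R, 0 < c & forall k, K k -> `|k| <= c * (u *m k) 0 0.
Proof.
have T0 : (K `&` [set x | `|x| = 1]) !=set0.
  exists (`|h|^-1 *: h); split => /=; first by apply: coneZ => //; rewrite invr_ge0.
  by rewrite normrZ gtr0_norm ?invr_gt0 ?normr_gt0// mulVf// normr_eq0.
have [|k0] := @compact_EVT_min _ R (fun k => (u *m k) 0 0) _ T0 compact_cone_sphere.
  apply: continuous_subspaceT => k.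
  exact: (cvg_comp _ _ (@mulmx_cts _ _ _ _ u k) (@coord_cts _ _ _ 0 0 _)).
rewrite inE => -[Kk0 /= k01] kmin.
have c0 : 0 < (u *m k0) 0 0.
  by apply: left_fix_gt0 => //; rewrite -normr_eq0 k01 oner_eq0.
exists ((u *m k0) 0 0)^-1; first by rewrite invr_gt0.
move=> k Kk; have [->|k_neq0] := eqVneq k 0; first by rewrite normr0 mulmx0 [X in _ * X]mxE mulr0.
have nk : 0 < `|k| by rewrite normr_gt0.
rewrite mulrC ler_pdivlMr// mulrC -ler_pdivlMr//.
have : `|k|^-1 *: k \in K `&` [set x | `|x| = 1].
  rewrite inE; split => /=; first by apply: coneZ => //; rewrite invr_ge0.
  by rewrite normrZ gtr0_norm ?invr_gt0// mulVf// gt_eqF.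
by move/kmin => /=; rewrite -scalemxAr [X in _ <= X -> _]mxE mulrC.
Qed.

(** The key comparison: on non-negative matrices the norm is equivalent to the
    linear form [u X h], the weight from which the measure is made. *)
Lemma cone_nonneg_bounds : exists2 C : R, 0 < C & forall X, cone_nonneg K X ->
  [/\ `|X| <= C * (u *m X *m h) 0 0, `|u *m X| <= C * (u *m X *m h) 0 0 &
      `|X *m h| <= C * (u *m X *m h) 0 0].
Proof.
have [c c0 uc] := left_fix_norm; have [C C0 KC] := cone_nonneg_norm hin.
have Xh X : cone_nonneg K X -> `|X *m h| <= c * (u *m X *m h) 0 0.
  by move=> KX; rewrite -mulmxA; exact/uc/KX.
have X_ge0 X : cone_nonneg K X -> 0 <= (u *m X *m h) 0 0.
  by move=> KX; rewrite -mulmxA; exact/left_fix_ge0/KX.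
have Xn X : cone_nonneg K X -> `|X| <= C * c * (u *m X *m h) 0 0.
  by move=> KX; rewrite (le_trans (KC X KX))// -mulrA ler_wpM2l ?Xh// ltW.
have du0 : 0 <= d%:R * `|u| by rewrite mulr_ge0.
have Cc0 : 0 < C * c by rewrite mulr_gt0.
exists (C * c + d%:R * `|u| * (C * c) + c) => [|X KX].
  by rewrite addr_gt0// ltr_pwDl// mulr_ge0// ltW.
have X0 := X_ge0 X KX; have duCc0 := mulr_ge0 du0 (ltW Cc0).
split.
- by rewrite (le_trans (Xn X KX))// ler_wpM2r//; lra.
- rewrite (le_trans (norm_mulmx _ _))//.
  rewrite (le_trans (ler_wpM2l du0 (Xn X KX)))// mulrA ler_wpM2r//; lra.
- by rewrite (le_trans (Xh X KX))// ler_wpM2r//; lra.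
Qed.

End Positive.

(** * Primitive matrices *)

Section Primitive.
Variable N : nat.
Hypotheses (N_gt0 : (0 < N)%N)
  (B_pos : forall k, K k -> k != 0 -> cone_inner (B ^+ N *m k)).

(** By compactness of the unit sphere of [K], the positive matrix [B ^+ N]
    dominates a multiple of the projection [Q]: a Doeblin minorisation. *)
Lemma minorisation : exists2 c : R, 0 < c < 1 &
  cone_nonneg K (B ^+ N - c *: Q).
Proof.
have nh : 0 < `|h| by rewrite normr_gt0.
have [t t0 Kt] : exists2 t : R, 0 < t &
    forall k, K k -> `|k| = 1 -> K (B ^+ N *m k - t *: h).
  have /compact_near_coveringP cov := compact_cone_sphere.
  have H : forall x, (K `&` [set x | `|x| = 1]) x ->
      \forall x' \near x & t \near (0 : R)^'+, K (B ^+ N *m x' - t *: h).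
    move=> x [Kx /= x1]; have x0 : x != 0 by rewrite -normr_eq0 x1 oner_eq0.
    have [e e0 xe] := B_pos Kx x0; have e20 : 0 < e / 2 by rewrite divr_gt0.
    exists ([set y | `|B ^+ N *m x - B ^+ N *m y| <= e / 2],
            [set t : R | 0 < t <= e / 2 / `|h|]); first split.
    - have /(_ x) := @mulmx_cts _ _ _ 1 (B ^+ N).
      by move/(@cvgrPdist_le _ _ _ (nbhs x))/(_ _ e20).
    - near=> t0; apply/andP; split; first by near: t0; exact: nbhs_right_gt.
      by near: t0; apply: nbhs_right_le; rewrite divr_gt0.
    - move=> [y t0] [/= yx /andP[t00 t0e]].
      have -> : B ^+ N *m y - t0 *: h =
          B ^+ N *m x - (B ^+ N *m x - B ^+ N *m y + t0 *: h).
        by rewrite opprD opprB addrA [B ^+ N *m x + _]addrC subrK.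
      apply: xe; rewrite normrN (le_trans (ler_normD _ _))// [e]splitr lerD//.
      by rewrite normrZ gtr0_norm// -ler_pdivlMr.
  have nt := cov _ _ (fun t k => K (B ^+ N *m k - t *: h)) _ H.
  have [t [t0 tK]] := filter_ex (filterI (nbhs_right_gt (0 : R)) (nt _)).
  by exists t => // k Kk k1; apply: tK.
(* [u k] is at most a multiple of the norm of [k]; the minimum with 1/2 only
   keeps [c] below 1. *)
pose c := Num.min 2^-1 (t / (d%:R * `|u| + 1)).
have du0 : 0 < d%:R * `|u| + 1 by rewrite ltr_wpDl// mulr_ge0.
exists c; first by rewrite lt_min gt_min invr_gt0 ltr0n divr_gt0//= invf_lt1// ltr1n.
move=> k Kk; have [->|k0] := eqVneq k 0; first by rewrite mulmx0; exact: cone0.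
have nk : 0 < `|k| by rewrite normr_gt0.
have uk : c * (u *m k) 0 0 <= t * `|k|.
  have ukn : (u *m k) 0 0 <= (d%:R * `|u| + 1) * `|k|.
    rewrite (le_trans (ler_norm _))// (le_trans (entry_le_norm _ _ _))//.
    by rewrite (le_trans (norm_mulmx _ _))// ler_wpM2r// lerDl.
  rewrite (@le_trans _ _ (t / (d%:R * `|u| + 1) * (u *m k) 0 0))//.
    by rewrite ler_wpM2r ?left_fix_ge0// ge_min lexx orbT.
  by rewrite -mulrA ler_wpM2l ?(ltW t0)// mulrC ler_pdivrMr// mulrC.
have -> : (B ^+ N - c *: Q) *m k = `|k| *: (B ^+ N *m (`|k|^-1 *: k) - t *: h) +
    (t * `|k| - c * (u *m k) 0 0) *: h.
  rewrite scalerBr (scalemxAr `|k|) scalerKV ?gt_eqF// scalerA mulrC.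
  rewrite scalerBl addrA subrK mulmxBl -scalemxAl -scalerA; congr (_ - _ *: _).
  by rewrite -mulmxA {1}[u *m k]mx11_scalar mul_mx_scalar.
apply: coneD; last by apply: coneZ => //; rewrite subr_ge0.
apply: coneZ => //; apply: Kt; first by apply: coneZ => //; rewrite invr_ge0.
by rewrite normrZ gtr0_norm ?invr_gt0// mulVf// gt_eqF.
Unshelve. all: by end_near. Qed.

Lemma subQX (X : 'M[R]_d) n : X *m Q = Q -> Q *m X = Q ->
  (X - Q) ^+ n.+1 = X ^+ n.+1 - Q.
Proof.
move=> XQ QX; elim: n => [//|n ih].
have QXn m : Q *m X ^+ m = Q.
  by elim: m => [|m im]; rewrite ?expr0 ?mulmx1// exprSr -mulmxE mulmxA im.
rewrite exprS ih -mulmxE mulmxBl !mulmxBr XQ mulQQ QXn subrr subr0.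
by rewrite mulmxE -exprS.
Qed.

(** Subtracting the minorising multiple of [Q] leaves a multiple, smaller than
    one, of a non-negative matrix that still fixes [h], hence has bounded
    powers. *)
Lemma primitive_power : exists (c C : R), [/\ 0 < c < 1, 0 < C &
  forall n, `|(B - Q) ^+ (N * n)| <= C * (1 - c) ^+ n].
Proof.
have [c /andP[c0 c1] Kc] := minorisation; have c1' : 0 < 1 - c by rewrite subr_gt0.
pose P := (1 - c)^-1 *: (B ^+ N - c *: Q).
have KP : cone_nonneg K P by apply: cone_nonnegZ => //; rewrite invr_ge0 ltW.
have Qh : Q *m h = h by rewrite -mulmxA uh mulmx1.
have uQ : u *m Q = u by rewrite mulmxA uh mul1mx.
have PQ : P *m Q = Q.
  rewrite -scalemxAl mulmxBl mulBQ -scalemxAl mulQQ -{1}[Q]scale1r -scalerBl.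
  by rewrite scalerK// gt_eqF.
have QP : Q *m P = Q.
  rewrite -scalemxAr mulmxBr mulQB -scalemxAr mulQQ -{1}[Q]scale1r -scalerBl.
  by rewrite scalerK// gt_eqF.
have Ph : P *m h = h by rewrite -{1}Qh mulmxA PQ Qh.
have PhX n : P ^+ n *m h = h.
  by elim: n => [|n ih]; rewrite ?expr0 ?mul1mx// exprSr -mulmxE -mulmxA Ph.
have [C C0 KC] := cone_nonneg_norm hin.
have BP : B ^+ N - Q = (1 - c) *: (P - Q).
  rewrite scalerBr scalerKV ?gt_eqF// scalerBl scale1r opprB addrA subrK.
  by [].
exists c, (C * `|h| + `|Q| + `|1 : 'M[R]_d| + 1); split.
- by rewrite c0.
- by rewrite ltr_wpDl// !addr_ge0// mulr_ge0// ltW.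
case=> [|n].
  by rewrite muln0 !expr0 mulr1 -addrA addrC -addrA lerDl !addr_ge0// mulr_ge0// ltW.
rewrite exprM -(prednK N_gt0) subQX; first last.
- exact: (mulQB 1).
- exact: (mulBQ 1).
rewrite (prednK N_gt0) BP exp_scale_mx subQX// normrZ normrX gtr0_norm// mulrC.
rewrite ler_wpM2r ?exprn_ge0 ?(ltW c1')// (le_trans (ler_normB _ _))//.
rewrite -!addrA lerD ?lerDl ?addr_ge0//.
by have := KC _ (cone_nonnegX n.+1 KP); rewrite PhX.
Qed.

End Primitive.
End LeftVector.
End FixedPoint.
End Cone.

(** * Eigenvalues and the growth of powers *)

Section Spectrum.
Context {R : realType}.
Local Notation normc := ComplexField.Normc.normc.
Local Notation toC := (real_complex R).

Lemma normc_ge0 (z : R[i]) : 0 <= normc z.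
Proof. by case: z => a b; rewrite /= sqrtr_ge0. Qed.

Lemma normc_real (a : R) : normc (toC a) = `|a|.
Proof. by rewrite /= expr0n/= addr0 sqrtr_sqr. Qed.

Lemma normcX (z : R[i]) n : normc (z ^+ n) = normc z ^+ n.
Proof.
elim: n => [|n ih]; first by rewrite !expr0 ComplexField.Normc.normc1.
by rewrite !exprS ComplexField.Normc.normcM ih.
Qed.

Lemma normc_sum (I : Type) (s : seq I) (F : I -> R[i]) :
  normc (\sum_(i <- s) F i) <= \sum_(i <- s) normc (F i).
Proof.
elim: s => [|i s ih]; first by rewrite !big_nil ComplexField.Normc.normc0.
rewrite !big_cons; apply: le_trans (le_normcD _ _) _.
by rewrite lerD2l.
Qed.

Lemma geometric_bounded (a C : R) : (forall n, a ^+ n <= C) -> a <= 1.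
Proof.
move=> aC; rewrite leNgt; apply/negP => a1.
have d0 : 0 < a - 1 by rewrite subr_gt0.
have ber n : 1 + n%:R * (a - 1) <= a ^+ n.
  elim: n => [|n ih]; first by rewrite mul0r addr0.
  rewrite exprS -natr1; apply: le_trans (ler_wpM2l (ltW (lt_trans ltr01 a1)) ih).
  have : 0 <= n%:R * (a - 1) ^+ 2 by rewrite mulr_ge0// sqr_ge0.
  by rewrite expr2; lra.
have := le_trans (ber (Num.truncn (C / (a - 1))).+1) (aC _).
have : C / (a - 1) < (Num.truncn (C / (a - 1))).+1%:R by rewrite truncnS_gt.
by rewrite ltr_pdivrMr//; lra.
Qed.

(** Compare a non-zero entry of [v T ^ n] with the same entry of [z ^ n v] for an
    eigenvector [v]. *)
Lemma eigen_le_growth d (T : 'M[R]_d) (r C : R) (z : R[i]) : 0 < r ->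
  (forall n, `|T ^+ n| <= C * r ^+ n) -> eigenvalue (map_mx toC T) z ->
  normc z <= r.
Proof.
move=> r0 TC /eigenvalueP[v vT v0].
have vTn n : v *m map_mx toC (T ^+ n) = z ^+ n *: v.
  elim: n => [|n ih]; first by rewrite !expr0 map_mx1 mulmx1 scale1r.
  by rewrite exprS -mulmxE map_mxM mulmxA vT -scalemxAl ih scalerA -exprS.
have [j vj] : exists j, v 0 j != 0.
  apply: contrapT => h; case/eqP: v0; apply/rowP => j; rewrite mxE.
  by apply: contrapT => /eqP vj; apply: h; exists j.
have nvj : 0 < normc (v 0 j).
  rewrite lt_neqAle normc_ge0 andbT eq_sym; apply: contra vj => /eqP.
  by move/ComplexField.Normc.eq0_normc => ->.
rewrite -[r]mul1r -ler_pdivrMr//.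
apply: (@geometric_bounded _ ((\sum_k normc (v 0 k)) * C / normc (v 0 j))) => n.
rewrite expr_div_n ler_pdivrMr ?exprn_gt0// mulrAC ler_pdivlMr//.
rewrite -normcX -ComplexField.Normc.normcM.
have := congr1 (fun M : 'rV_d => normc (M 0 j)) (vTn n); rewrite !mxE => <-.
rewrite (le_trans (normc_sum _ _))// -mulrA mulr_suml ler_sum// => k _.
rewrite ComplexField.Normc.normcM ler_wpM2l ?normc_ge0// mxE normc_real.
by rewrite (le_trans (entry_le_norm _ _ _)).
Qed.

(** If a product of factors [T - l] kills [X] then the orbit [T ^+ n X] grows
    at most like [r ^+ n] for every [r] exceeding all the [|l|]: peel off one
    factor at a time, each costing a first-order linear recursion. *)
Lemma annihilated_growth d m (T : 'M[R[i]]_d) (r : R) (s : seq R[i])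
    (X : 'M[R[i]]_(d, m)) : 0 < r -> (forall l, l \in s -> normc l < r) ->
  (\prod_(l <- s) (T - l%:M)) *m X = 0 ->
  exists2 C : R, 0 <= C & forall n i j, normc ((T ^+ n *m X) i j) <= C * r ^+ n.
Proof.
move=> r0; elim: s X => [|l s ih] X sr.
  rewrite big_nil mul1mx => ->; exists 0 => // n i j.
  by rewrite mulmx0 mxE ComplexField.Normc.normc0 mul0r.
rewrite big_cons => sX.
have lr : normc l < r by apply: sr; rewrite mem_head.
have [k ks||C C0 YC] := ih ((T - l%:M) *m X).
  by apply: sr; rewrite in_cons ks orbT.
  have comml : GRing.comm (T - l%:M) (\prod_(l <- s) (T - l%:M)).
    apply: commr_prod => k _.
    have sC (a : R[i]) (M : 'M[R[i]]_d) : GRing.comm M (a%:M).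
      by rewrite /GRing.comm -!mulmxE scalar_mxC.
    by apply: commrB => //; apply/commr_sym; apply: commrB => //; exact/commr_sym.
  by rewrite mulmxA mulmxE -comml.
have d0 : 0 < r - normc l by rewrite subr_gt0.
pose S := \sum_i \sum_j normc (X i j).
have S0 : 0 <= S by do 2!(apply: sumr_ge0 => ? _); exact: normc_ge0.
have XS i j : normc (X i j) <= S.
  rewrite /S (bigD1 i)//= (bigD1 j)//= -addrA lerDl addr_ge0//.
    by apply: sumr_ge0 => ? _; exact: normc_ge0.
  by do 2!(apply: sumr_ge0 => ? _); exact: normc_ge0.
exists (C / (r - normc l) + S) => [|n i j]; first by rewrite addr_ge0// divr_ge0// ltW.
elim: n i j => [|n IH] i j.
  rewrite !expr0 mul1mx mulr1 (le_trans (XS i j))// lerDr divr_ge0//; exact: ltW.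
have -> : T ^+ n.+1 *m X = T ^+ n *m ((T - l%:M) *m X) + l *: (T ^+ n *m X).
  rewrite mulmxBl mulmxBr mul_scalar_mx -scalemxAr subrK.
  by rewrite exprSr -mulmxE mulmxA.
rewrite mxE [X in _ + X]mxE; apply: le_trans (le_normcD _ _) _.
rewrite ComplexField.Normc.normcM.
apply: le_trans (lerD (YC n i j) (ler_wpM2l (normc_ge0 l) (IH i j))) _.
rewrite exprS mulrA mulrA -mulrDl ler_wpM2r ?exprn_ge0 ?(ltW r0)//.
rewrite -subr_ge0.
have -> : (C / (r - normc l) + S) * r - (C + normc l * (C / (r - normc l) + S)) =
   S * (r - normc l) by field; rewrite gt_eqF.
by rewrite mulr_ge0// ltW.
Qed.

(** By the Cayley-Hamilton theorem the product of the factors [T - z] over the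
    complex roots of the characteristic polynomial annihilates everything. *)
Lemma power_growth d (T : 'M[R]_d) (r : R) : 0 < r ->
  (forall z, eigenvalue (map_mx toC T) z -> normc z < r) ->
  exists2 C : R, 0 <= C & forall n, `|T ^+ n| <= C * r ^+ n.
Proof.
move=> r0; case: d T => [|d] T Tr.
  exists 0 => // n; apply: norm_le_entry => [|i]; first by rewrite mul0r.
  by case: i.
pose TC := map_mx toC T; have [s sE] := closed_field_poly_normal (char_poly TC).
have sr l : l \in s -> normc l < r.
  move=> ls; apply: Tr; rewrite eigenvalue_root_char -/TC sE.
  rewrite (monicP (char_poly_monic TC)) scale1r root_prod_XsubC.
  exact: ls.
have := Cayley_Hamilton TC; rewrite sE (monicP (char_poly_monic TC)) scale1r.
rewrite rmorph_prod (eq_bigr (fun l => TC - l%:M)) => [s0|l _]; last first.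
  by rewrite rmorphB /= horner_mx_X horner_mx_C.
have [|C C0 CP] := @annihilated_growth _ _ TC r s 1%:M r0 sr.
  by rewrite mulmx1.
exists C => // n; apply: norm_le_entry => [|i j].
  by rewrite mulr_ge0// exprn_ge0// ltW.
have := CP n i j; rewrite mulmx1 -rmorphXn mxE normc_real.
exact.
Qed.

End Spectrum.

(** * The Perron-Frobenius theorem for a cone *)

Section PerronFrobenius.
Context {R : realType}.
Local Notation normc := ComplexField.Normc.normc.
Local Notation toC := (real_complex R).

Definition normalised d (A : 'M[R]_d) : 'M[R]_d := (spectral_radius A)^-1 *: A.

(** The midpoint between 1 and the largest modulus of a non-dominant eigenvalue
    relative to the spectral radius. Staying strictly above that modulus
    absorbs the polynomial factors coming from Jordan blocks, and makes the rate
    a function of the set of eigenvalues alone. *)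
Definition mixing_rate (S : set R[i]) : R :=
  let rho := sup [set normc z | z in S] in
  (1 + sup [set normc z / rho | z in [set z | S z /\ z <> toC rho]]) / 2.

(** Growth of the powers bounds every eigenvalue, and the left eigenvector [u]
    shows that the bound is attained. *)
Lemma spectral_radiusE d (A : 'M[R]_d) (rho C : R) (u : 'rV[R]_d) : 0 < rho ->
  (forall n, `|A ^+ n| <= C * rho ^+ n) -> u != 0 -> u *m A = rho *: u ->
  spectral_radius A = rho.
Proof.
move=> rho0 AC u0 uA.
have ub : ubound [set normc z | z in spectrum A] rho.
  by move=> _ [z zA <-]; exact: eigen_le_growth rho0 AC zA.
have mem : [set normc z | z in spectrum A] rho.
  exists (toC rho); last by rewrite normc_real gtr0_norm.
  apply/eigenvalueP; exists (map_mx toC u); last by rewrite map_mx_eq0.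
  by rewrite -map_mxM uA map_mxZ.
apply/eqP; rewrite eq_le; apply/andP; split.
  by apply: ge_sup ub; exists rho.
by apply: ub_le_sup mem; exists rho.
Qed.

(** An upper bound for an [N]-th root which, unlike the root itself, is visibly
    below 1 (Bernoulli's inequality). *)
Lemma root_bound (x c : R) N : (0 < N)%N -> 0 <= x -> 0 < c < 1 ->
  x ^+ N <= 1 - c -> x <= 1 - c / N%:R.
Proof.
move=> N0 x0 /andP[c0 c1] xN.
have N0' : 0 < N%:R :> R by rewrite ltr0n.
have t0 : 0 <= 1 - c / N%:R.
  rewrite subr_ge0 ler_pdivrMr// mul1r (le_trans (ltW c1))//.
  by rewrite ler1n.
have t1 : c / N%:R <= 1 by rewrite -subr_ge0.
have ber n : 1 - n%:R * (c / N%:R) <= (1 - c / N%:R) ^+ n.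
  elim: n => [|n ih]; first by rewrite mul0r subr0.
  rewrite exprS -natr1; apply: le_trans (ler_wpM2l t0 ih).
  have : 0 <= n%:R * (c / N%:R) ^+ 2 by rewrite mulr_ge0// sqr_ge0.
  by rewrite expr2; lra.
rewrite -(ler_pXn2r N0) ?nnegrE//; apply: le_trans xN (le_trans _ (ber N)).
by rewrite mulrC divfK// gt_eqF.
Qed.

Section Decay.
Context {d : nat} (B Q : 'M[R]_d) (N : nat) (c C : R).
Hypotheses (BQ : B *m Q = Q) (QB : Q *m B = Q) (QQ : Q *m Q = Q).
Hypotheses (N_gt0 : (0 < N)%N) (c01 : 0 < c < 1).
Hypothesis BN : forall n, `|(B - Q) ^+ (N * n)| <= C * (1 - c) ^+ n.

Let c1 : 0 < 1 - c. Proof. by case/andP: c01 => ? ?; rewrite subr_gt0. Qed.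

Lemma eigen_complement (z : R[i]) : eigenvalue (map_mx toC (B - Q)) z ->
  normc z <= 1 - c / N%:R.
Proof.
move=> zT; apply: root_bound => //; first exact: normc_ge0.
have BNn n : `|((B - Q) ^+ N) ^+ n| <= C * (1 - c) ^+ n by rewrite -exprM.
have zN : eigenvalue (map_mx toC ((B - Q) ^+ N)) (z ^+ N).
  have /eigenvalueP[v vT v0] := zT; apply/eigenvalueP; exists v => //.
  elim: (N) => [|n ih]; first by rewrite !expr0 map_mx1 mulmx1 scale1r.
  by rewrite !exprS -mulmxE map_mxM mulmxA vT -scalemxAl ih scalerA.
by rewrite -normcX; exact: eigen_le_growth c1 BNn zN.
Qed.

(** Non-zero eigenvalues of [B - Q] are eigenvalues of [B] whose eigenvectors are
    killed by [Q]; conversely every eigenvalue of [B] other than 1 is an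
    eigenvalue of [B - Q]. *)
Lemma eigen_restrict (z : R[i]) (v : 'rV[R[i]]_d) : z != 0 ->
  v *m map_mx toC (B - Q) = z *: v ->
  v *m map_mx toC Q = 0 /\ v *m map_mx toC B = z *: v.
Proof.
move=> z0 vT.
have vQ : v *m map_mx toC Q = 0.
  apply/eqP; rewrite -(inj_eq (scalerI z0)) scaler0 scalemxAl -vT -mulmxA.
  by rewrite -map_mxM mulmxBl BQ QQ subrr map_mx0 mulmx0.
by split => //; rewrite -vT map_mxB mulmxBr vQ subr0.
Qed.

Lemma eigen_corestrict (z : R[i]) (v : 'rV[R[i]]_d) : z != 1 ->
  v *m map_mx toC B = z *: v -> v *m map_mx toC (B - Q) = z *: v.
Proof.
move=> z1 vB; suff vQ : v *m map_mx toC Q = 0.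
  by rewrite map_mxB mulmxBr vQ subr0.
have : v *m map_mx toC Q = z *: (v *m map_mx toC Q).
  by rewrite scalemxAl -vB -mulmxA -map_mxM BQ.
move/eqP; rewrite -subr_eq0 -{1}[_ *m _]scale1r -scalerBl scaler_eq0.
by rewrite subr_eq0 eq_sym (negPf z1) => /eqP.
Qed.

Variables (A : 'M[R]_d).
Hypotheses (rho_gt0 : 0 < spectral_radius A) (B_def : B = normalised A).

Let rho := spectral_radius A.
Let E := [set normc z / rho | z in [set z | spectrum A z /\ z <> toC rho]].

Let toC_neq0 : toC rho != 0.
Proof. by rewrite fmorph_eq0 gt_eqF. Qed.

Let A_def : A = rho *: B.
Proof. by rewrite B_def scalerA divff ?scale1r// gt_eqF. Qed.

Let E_ub : ubound E (1 - c / N%:R).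
Proof.
move=> _ [z [/eigenvalueP[v vA v0] zrho] <-].
have -> : normc z / rho = normc (z / toC rho).
  by rewrite ComplexField.Normc.normcM ComplexField.Normc.normcV normc_real gtr0_norm.
apply: eigen_complement; apply/eigenvalueP; exists v => //.
apply: eigen_corestrict.
  by apply/eqP => /(canRL (divfK toC_neq0)); rewrite mul1r.
apply: (scalerI toC_neq0); rewrite scalerA mulrC divfK// -vA A_def.
by rewrite map_mxZ scalemxAr.
Qed.

Let E_sup_lt1 : sup E < 1.
Proof.
have [E0|/set0P/negP] := pselect (E !=set0); last first.
  by rewrite negbK => /eqP ->; rewrite sup0 ltr01.
apply: le_lt_trans (ge_sup E0 E_ub) _; rewrite gtrBl divr_gt0 ?ltr0n//.
by case/andP: c01.
Qed.

Let E_sup_ge x : E x -> x <= sup E.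
Proof. by move=> Ex; apply: ub_le_sup Ex; exists (1 - c / N%:R); exact: E_ub. Qed.

Let E_sup_ge0 : 0 <= sup E.
Proof.
have [[x Ex]|/set0P/negP] := pselect (E !=set0); last first.
  by rewrite negbK => /eqP ->; rewrite sup0.
apply: le_trans (E_sup_ge Ex); case: Ex => z _ <-.
by rewrite divr_ge0// ?normc_ge0// ltW.
Qed.

Lemma mixing_rate_lt1 : 0 < mixing_rate (spectrum A) < 1.
Proof.
rewrite /mixing_rate -/(spectral_radius A) -/rho -/E.
move: E_sup_lt1 E_sup_ge0; lra.
Qed.

Lemma complement_decay : exists2 D : R, 0 <= D &
  forall n, `|(B - Q) ^+ n| <= D * mixing_rate (spectrum A) ^+ n.
Proof.
have /andP[r0 _] := mixing_rate_lt1.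
apply: power_growth => // z zT.
apply: (@le_lt_trans _ _ (sup E)); last first.
  rewrite /mixing_rate -/(spectral_radius A) -/rho -/E.
  by move: E_sup_lt1; lra.
have [->|z0] := eqVneq z 0; first by rewrite ComplexField.Normc.normc0.
have /eigenvalueP[v vT v0] := zT; have [vQ vB] := eigen_restrict z0 vT.
apply: E_sup_ge; exists (toC rho * z); last first.
  rewrite ComplexField.Normc.normcM normc_real gtr0_norm// mulrC.
  by rewrite mulKf// gt_eqF.
split.
  apply/eigenvalueP; exists v => //.
  by rewrite A_def map_mxZ -scalemxAr vB scalerA.
move=> /(canRL (mulKf toC_neq0)); rewrite mulVf// => z1.
have := eigen_complement zT; rewrite z1 ComplexField.Normc.normc1.
by rewrite lerDl oppr_ge0 leNgt divr_gt0// ?ltr0n//; case/andP: c01.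
Qed.

End Decay.

(** Irreducibility suffices for the eigenvectors, the comparison of norms with
    weights and the bounded ergodic sums; periodic behaviour on the circle of
    radius [spectral_radius A] is excluded only by primitivity. *)
Theorem perron_frobenius d (A : 'M[R]_d) (K : set 'cV[R]_d) :
  is_cone K -> closed K -> K <> [set 0] -> cone_nonneg K A ->
  cone_irreducible K A -> A != 0 ->
  exists (u : 'rV[R]_d) (h : 'cV[R]_d) (C : R),
  let B := normalised A in
  [/\ 0 < spectral_radius A /\ 0 < C,
      [/\ B *m h = h, u *m B = u & u *m h = 1],
      forall X, cone_nonneg K X ->
        [/\ `|X| <= C * (u *m X *m h) 0 0, `|u *m X| <= C * (u *m X *m h) 0 0 &
            `|X *m h| <= C * (u *m X *m h) 0 0],
      forall n, `|\sum_(i < n) (B ^+ i - h *m u)| <= C &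
      cone_primitive K A -> 0 < mixing_rate (spectrum A) < 1 /\
        exists2 D, 0 <= D &
          forall n, `|B ^+ n - h *m u| <= D * mixing_rate (spectrum A) ^+ n].
Proof.
move=> coneK closedK K0 KA irrA A0.
have [rho [h [rho0 hin h0 Ah]]] := perron_vector coneK closedK KA irrA K0 A0.
pose B := rho^-1 *: A.
have Bh : B *m h = h by rewrite -scalemxAl Ah scalerK// gt_eqF.
have KB : cone_nonneg K B by apply: cone_nonnegZ => //; rewrite invr_ge0 ltW.
have AB : A = rho *: B by rewrite scalerA divff ?scale1r// gt_eqF.
have fixB x : K x -> x != 0 -> B *m x = x -> cone_inner K x.
  move=> Kx x0 Bx; apply: (eigen_inner coneK irrA (ltW rho0) Kx x0).
  by rewrite AB -scalemxAl Bx.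
have [u uB uh] := left_fix_normalised coneK closedK KB hin h0 Bh fixB.
have uA : u *m A = rho *: u by rewrite AB -scalemxAr uB.
have uAn n : u *m A ^+ n = rho ^+ n *: u.
  elim: n => [|n ih]; first by rewrite !expr0 mulmx1 scale1r.
  by rewrite exprSr -mulmxE mulmxA ih -scalemxAl uA scalerA -exprSr.
have u0 : u != 0.
  by apply/eqP => u0; have /matrixP/(_ 0 0)/eqP := uh; rewrite u0 mul0mx !mxE eq_sym oner_eq0.
have [C0 C00 BC] := power_bounded coneK closedK KB hin h0 Bh.
have rhoE : spectral_radius A = rho.
  apply: (@spectral_radiusE _ A rho C0 u) => // n.
  by rewrite AB exp_scale_mx normrZ normrX gtr0_norm// mulrC ler_wpM2r// exprn_ge0// ltW.
have BE : normalised A = B by rewrite /normalised rhoE.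
have uS : u *m \sum_(k < d) A ^+ k = (\sum_(k < d) rho ^+ k) *: u.
  by rewrite mulmx_sumr scaler_suml; apply: eq_bigr => k _; exact: uAn.
have S_pos k : K k -> k != 0 -> cone_inner K ((\sum_(k < d) A ^+ k) *m k).
  by move=> Kk k0; exact/interior_cone_inner/irrA.
have [C1 C10 XC] := cone_nonneg_bounds coneK closedK KB hin h0 Bh fixB uB uh S_pos uS.
have [C2 C20 EC] := mean_ergodic coneK closedK KB hin h0 Bh fixB uB uh.
exists u, h, (C1 + C2); rewrite /= BE; split => //.
- by rewrite rhoE addr_gt0.
- move=> X KX; have [X1 X2 X3] := XC X KX.
  have X0 : 0 <= (u *m X *m h) 0 0 by move: (le_trans (normr_ge0 _) X1); rewrite pmulr_rge0.
  have CC : C1 * (u *m X *m h) 0 0 <= (C1 + C2) * (u *m X *m h) 0 0.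
    by rewrite ler_wpM2r// lerDl ltW.
  by split; [exact: le_trans X1 _|exact: le_trans X2 _|exact: le_trans X3 _].
- by move=> n; rewrite (le_trans (EC n))// lerDr ltW.
move=> [N AN].
(* One more factor [B] makes the exponent positive, as [B - Q] and [B] have
   comparable powers only from the first power on. *)
have BN_pos k : K k -> k != 0 -> cone_inner K (B ^+ N.+1 *m k).
  move=> Kk k0; rewrite exprSr -mulmxE -mulmxA.
  have Bk : B *m k != 0.
    apply/eqP => Bk; have := left_fix_gt0 coneK closedK KB hin h0 Bh fixB uB uh S_pos uS Kk k0.
    by rewrite -uB -mulmxA Bk mulmx0 mxE ltxx.
  rewrite exp_scale_mx -scalemxAl; apply: cone_innerZ => //.
    by rewrite exprn_gt0// invr_gt0.
  by apply: interior_cone_inner; apply: AN => //; exact: KB.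
have [c [C3 [c01 C30 BNC]]] := primitive_power coneK closedK KB hin h0 Bh fixB uB uh (ltn0Sn N) BN_pos.
have rho0' : 0 < spectral_radius A by rewrite rhoE.
have BQ := mulBQ Bh u 1; rewrite expr1 in BQ.
have QB := mulQB h uB 1; rewrite expr1 in QB.
have QQ := mulQQ uh.
split; first exact: (mixing_rate_lt1 BQ (ltn0Sn N) c01 BNC rho0' (esym BE)).
have [D D0 BD] := complement_decay BQ QQ (ltn0Sn N) c01 BNC rho0' (esym BE).
have Q0 : 0 <= `|h *m u| by [].
exists (D + `|h *m u| + `|1 : 'M[R]_d|) => [|n]; first by rewrite !addr_ge0.
case: n => [|n].
  rewrite !expr0 mulr1 (le_trans (ler_normB _ _))// addrC lerD2r.
  by rewrite lerDr.
rewrite -(subQX uh n BQ QB) (le_trans (BD _))// ler_wpM2r//.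
  rewrite exprn_ge0//; have /andP[] := mixing_rate_lt1 BQ (ltn0Sn N) c01 BNC rho0' (esym BE).
  by move=> /ltW.
by rewrite -addrA lerDl addr_ge0.
Qed.

End PerronFrobenius.

(** * Words and windows *)

Section Words.
Variable M : nat.
Local Notation I := 'I_M.+1.

Fixpoint words (n : nat) : seq (seq I) :=
  if n is n'.+1 then [seq i :: w | i <- enum I, w <- words n'] else [:: [::]].

Lemma size_words n w : w \in words n -> size w = n.
Proof.
elim: n w => [|n ih] w; first by rewrite inE => /eqP ->.
by move=> /allpairsP[[i v] [_ /= /ih vn ->]] /=; rewrite vn.
Qed.

Section Sums.
Variable V : nmodType.

Lemma sum_words0 (F : seq I -> V) : \sum_(w <- words 0) F w = F [::].
Proof. by rewrite big_seq1. Qed.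

Lemma sum_words_cons n (F : seq I -> V) :
  \sum_(w <- words n.+1) F w = \sum_i \sum_(w <- words n) F (i :: w).
Proof.
rewrite /= big_flatten big_map big_enum; apply: eq_bigr => i _.
by rewrite big_map.
Qed.

Lemma sum_words_cat m n (F : seq I -> V) :
  \sum_(w <- words (m + n)) F w =
  \sum_(v <- words m) \sum_(w <- words n) F (v ++ w).
Proof.
elim: m F => [|m ih] F; first by rewrite sum_words0.
by rewrite addSn !sum_words_cons; apply: eq_bigr => i _; rewrite ih.
Qed.

Lemma sum_words_rcons n (F : seq I -> V) :
  \sum_(w <- words n.+1) F w = \sum_(w <- words n) \sum_i F (rcons w i).
Proof.
rewrite -[n.+1]addn1 sum_words_cat; apply: eq_bigr => v _.
rewrite sum_words_cons; apply: eq_bigr => i _.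
by rewrite sum_words0 cats1.
Qed.

Lemma sum_words_delta (F : seq I -> V) w :
  \sum_(y <- words (size w)) (if y == w then F y else 0) = F w.
Proof.
elim: w F => [|j w ih] F; first by rewrite sum_words0.
rewrite sum_words_cons (bigD1 j)//= [X in _ + X]big1 ?addr0.
  rewrite -[RHS](ih (fun y => F (j :: y))); apply: eq_bigr => y _.
  by rewrite eqseq_cons eqxx.
by move=> i /negPf ij; rewrite big1// => y _; rewrite eqseq_cons ij.
Qed.

End Sums.

Implicit Types (x y : fullshift M) (w : seq I).

Definition block x (a : int) (n : nat) : seq I :=
  mkseq (fun k => x (a + k%:Z) : I) n.

Lemma size_block x a n : size (block x a n) = n.
Proof. by rewrite size_mkseq. Qed.

Lemma block_cat x a m n :
  block x a (m + n) = block x a m ++ block x (a + m%:Z) n.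
Proof.
rewrite /block /mkseq iotaD map_cat; congr (_ ++ _).
rewrite add0n -[m in iota m]addn0 iotaDl -map_comp; apply: eq_map => k /=.
by rewrite PoszD addrA.
Qed.

Lemma block1 x a : block x a 1 = [:: (x a : I)].
Proof. by rewrite /block /mkseq /= addr0. Qed.

Lemma iter_shift n x (i : int) : iter n (@shift_map M) x i = x (i + n%:Z).
Proof.
elim: n i => [|n ih] i; first by rewrite addr0.
by rewrite iterS /shift_map ih -addrA [1 + _]addrC -PoszD addn1.
Qed.

Lemma block_shift n x a m :
  block (iter n (@shift_map M) x) a m = block x (a + n%:Z) m.
Proof. by apply: eq_mkseq => k; rewrite iter_shift addrAC. Qed.

(** Cylinders at an arbitrary position, by equality of words, so that
    concatenation of words is intersection of cylinders. *)
Definition cyl (a : int) w : set (fullshift M) :=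
  [set x | block x a (size w) = w].

Lemma cyl_nil a : cyl a [::] = setT.
Proof. by apply/seteqP; split. Qed.

Lemma cyl_cat a v w : cyl a (v ++ w) = cyl a v `&` cyl (a + (size v)%:Z) w.
Proof.
apply/seteqP; split => x; rewrite /cyl /= size_cat block_cat.
  by move/eqP; rewrite eqseq_cat ?size_block// => /andP[/eqP -> /eqP ->].
by case=> -> ->.
Qed.

Lemma cyl_shift a n w :
  iter n (@shift_map M) @^-1` cyl a w = cyl (a + n%:Z) w.
Proof. by apply/seteqP; split => x; rewrite /cyl /= block_shift. Qed.

Lemma cylinder_cyl x n : cylinder x n = cyl 0 (block x 0 n).
Proof.
apply/seteqP; split => y; rewrite /cylinder /cyl /= size_block.
  move=> yx; apply: (@eq_from_nth _ ord0); rewrite !size_block// => k kn.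
  by rewrite !nth_mkseq// add0r yx.
move=> yx k kn; have := congr1 (fun s => nth ord0 s k) yx.
by rewrite !nth_mkseq// !add0r.
Qed.

Definition agree (n : nat) x y : Prop :=
  forall i : int, - n%:Z <= i < n%:Z -> x i = y i.

(** The position of the coordinate [i] in a block starting at [-n]. *)
Definition offset (n : nat) (i : int) : nat := absz (i + n%:Z).

Lemma agree_sym n x y : agree n x y -> agree n y x.
Proof. by move=> xy i /xy. Qed.

Lemma agree_trans n x y z : agree n x y -> agree n y z -> agree n x z.
Proof. by move=> xy yz i ni; rewrite xy// yz. Qed.

Lemma agreeW m n x y : (m <= n)%N -> agree n x y -> agree m x y.
Proof. by move=> mn xy i mi; apply: xy; lia. Qed.

Lemma agree_block n x y :
  agree n x y <-> block x (- n%:Z) n.*2 = block y (- n%:Z) n.*2.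
Proof.
split=> [xy|xy i ni].
  apply: (@eq_from_nth _ ord0); rewrite !size_block// => k kn.
  by rewrite !nth_mkseq//; apply: xy; lia.
have := congr1 (fun s => nth ord0 s (offset n i)) xy.
have kn : (offset n i < n.*2)%N by rewrite /offset; lia.
rewrite !nth_mkseq//.
by have -> : - n%:Z + (offset n i)%:Z = i by rewrite /offset; lia.
Qed.

(** Only the letters on the window [-n <= i < n] matter; the absolute value in
    [offset] and the default of [nth] fill the other coordinates. *)
Definition extend (n : nat) w : fullshift M :=
  fun i => nth ord0 w (offset n i).

Lemma block_extend n w : size w = n.*2 -> block (extend n w) (- n%:Z) n.*2 = w.
Proof.
move=> wn; apply: (@eq_from_nth _ ord0); rewrite ?size_block// => k kn.
rewrite nth_mkseq// /extend; congr nth; rewrite /offset; lia.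
Qed.

Lemma agree_extend n w x : size w = n.*2 ->
  agree n x (extend n w) <-> cyl (- n%:Z) w x.
Proof. by move=> wn; rewrite agree_block block_extend// /cyl /= wn. Qed.

Lemma agree_extendS n w i j : size w = n.*2 ->
  agree n (extend n.+1 (i :: rcons w j)) (extend n w).
Proof.
move=> wn k kn; rewrite /extend.
have -> : offset n.+1 k = (offset n k).+1 by rewrite /offset; lia.
by rewrite /= nth_rcons wn ifT// /offset; lia.
Qed.

(** Sets determined by finitely many coordinates; they form the algebra from
    which the Borel sets are generated. *)
Definition window_set (n : nat) (E : set (fullshift M)) : Prop :=
  forall x y, agree n x y -> E x -> E y.

Lemma window_setW m n E : (m <= n)%N -> window_set m E -> window_set n E.
Proof. by move=> mn Em x y /(agreeW mn); exact: Em. Qed.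

Lemma window_setE n E x y : window_set n E -> agree n x y -> E x = E y.
Proof.
move=> En xy; apply/propext; split; first exact: En.
by apply: En; exact: agree_sym.
Qed.

Definition local_set (E : set (fullshift M)) : Prop := exists n, window_set n E.

Lemma local_setI E F : local_set E -> local_set F -> local_set (E `&` F).
Proof.
move=> [m Em] [n Fn]; exists (maxn m n) => x y xy [Ex Fx]; split.
  exact: (window_setW (leq_maxl m n) Em xy Ex).
exact: (window_setW (leq_maxr m n) Fn xy Fx).
Qed.

Lemma local_setC E : local_set E -> local_set (~` E).
Proof. by move=> [n En]; exists n => x y xy; apply: contra_not; exact/En/agree_sym. Qed.

Lemma local_setT : local_set setT. Proof. by exists 0%N. Qed.

Lemma window_cyl a w : window_set (absz a + size w)%N (cyl a w).
Proof.
move=> x y xy.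
rewrite /cyl /= => xw; rewrite -[RHS]xw; apply: (@eq_from_nth _ ord0); rewrite !size_block// => k kn.
by rewrite !nth_mkseq//; apply/esym/xy; lia.
Qed.

Lemma local_cyl a w : local_set (cyl a w).
Proof. by eexists; exact: window_cyl. Qed.

Lemma local_shift E : local_set E -> local_set (@shift_map M @^-1` E).
Proof.
move=> [n En]; exists n.+1 => x y xy /=; apply: En => i ni.
by apply: xy; lia.
Qed.

(** * Topology of the full shift *)

Lemma fullshift_compact : compact [set: fullshift M].
Proof.
have -> : [set: fullshift M] = [set f | forall i, [set: discrete_topology I] (f i)].
  by apply/seteqP; split.
apply: (@tychonoff _ (fun _ : int => discrete_topology I) (fun=> setT)) => i.
apply: finite_compact; exact: (@finite_finset I).
Qed.

(** A finite intersection of preimages of points of a discrete space. *)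
Lemma local_set_open E : local_set E -> open E.
Proof.
move=> [n En]; rewrite openE => x Ex; rewrite /interior.
have near_i (i : int) : nbhs x [set y : fullshift M | y i = x i].
  have /(_ x) : continuous (fun y : fullshift M => y i : discrete_topology I).
    by move=> z A zA; exact: (@proj_continuous int (fun=> discrete_topology I) i z A zA).
  by move=> /(_ _ (discrete_set1 (x i : discrete_topology I))).
have near_w : nbhs x [set y : fullshift M |
    forall k : 'I_n.*2, y (- n%:Z + k%:Z) = x (- n%:Z + k%:Z)].
  exact: (@filter_forall _ _ _ (nbhs x) (nbhs_filter x)
    (fun k : 'I_n.*2 => near_i (- n%:Z + k%:Z))).
apply: filterS near_w => y xy; apply: En Ex => i ni; apply/esym.
have kn : (offset n i < n.*2)%N by rewrite /offset; lia.
have := xy (Ordinal kn) => /=.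
by have -> : - n%:Z + (offset n i)%:Z = i by rewrite /offset; lia.
Qed.

(** The windows around [x] generate a filter that converges coordinatewise, hence
    in the product topology. *)
Lemma open_window (U : set (fullshift M)) x : open U -> U x ->
  exists n, forall y, agree n x y -> U y.
Proof.
move=> oU Ux; pose F := filter_from setT (fun n => [set y | agree n x y]).
have FF : Filter F.
  apply: filter_from_filter; first by exists 0%N.
  move=> m n _ _; exists (maxn m n) => // y xy; split.
    by apply: agreeW xy; exact: leq_maxl.
  by apply: agreeW xy; exact: leq_maxr.
have : F --> (x : prod_topology (fun _ : int => discrete_topology I)).
  apply/cvg_sup => i V [W [[A oA <-] Ax] WV].
  apply: filterS WV _; exists (absz i).+1 => // y xy /=.
  by rewrite -(xy i)//; lia.
move=> /(_ U); case; first exact: open_nbhs_nbhs.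
by move=> n _ nU; exists n.
Qed.

(** Exhaust [U] by the points whose whole cylinder on [-n <= i < n] stays in
    [U]. *)
Lemma open_bigcup_local (U : set (fullshift M)) : open U ->
  exists2 F : nat -> set (fullshift M), (forall n, local_set (F n)) &
    U = \bigcup_n F n.
Proof.
move=> oU; exists (fun n => [set x | forall y, agree n x y -> U y]) => [n|].
  exists n => x y xy xU z yz; apply: xU; exact: agree_trans xy yz.
apply/seteqP; split => [x Ux|x [n _]].
  by have [n nU] := open_window oU Ux; exists n.
by apply.
Qed.

Lemma measurable_local : @measurable _ (fullshift M) = <<s local_set >>.
Proof.
apply/seteqP; split; apply: smallest_sub; try exact: smallest_sigma_algebra.
  move=> U /open_bigcup_local[F Floc ->].
  apply: sigma_algebra_bigcup => n; exact: sub_sigma_algebra.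
by move=> E /local_set_open oE; exact: sub_sigma_algebra.
Qed.

Lemma local_measurable E : local_set E -> measurable E.
Proof. by move=> Eloc; rewrite measurable_local; exact: sub_sigma_algebra. Qed.

End Words.

(** * The shift-invariant measure with given word probabilities *)

(** Local sets form an algebra generating the Borel sets; this copy of the
    full shift carries it so that a premeasure can live on it. *)
Definition local_space (M : nat) : Type := fullshift M.

Section LocalSpace.
Variable M : nat.

Lemma local_setD : setD_closed (@local_set M).
Proof. by move=> A B lA lB; rewrite setDE; apply: local_setI => //; exact: local_setC. Qed.

HB.instance Definition _ := Pointed.on (local_space M).
HB.instance Definition _ := isAlgebraOfSets_setD.Build default_measure_display
  (local_space M) (@local_setT M) local_setD.

End LocalSpace.

Section WordMeasure.
Context {R : realType} {M : nat}.
Local Notation I := 'I_M.+1.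
Variable p : seq I -> R.
Hypotheses (p_ge0 : forall w, 0 <= p w) (p_nil : p [::] = 1).
Hypotheses (p_cons : forall w, \sum_i p (i :: w) = p w)
  (p_rcons : forall w, \sum_i p (rcons w i) = p w).

(** The sum of the weights of the words on the window [-n <= i < n], each placed as
    a point mass at the point carrying that word. *)
Definition window_weight (n : nat) (E : set (fullshift M)) : R :=
  \sum_(w <- words M n.*2) p w * \1_E (extend n w).

(** Consistency of the weights at both ends makes the mass of a set independent of
    the window, once it determines the set. *)
Lemma window_weightS n E : window_set n E ->
  window_weight n.+1 E = window_weight n E.
Proof.
move=> En; rewrite /window_weight doubleS sum_words_cons.
under eq_bigr do rewrite sum_words_rcons.
rewrite exchange_big /= big_seq [RHS]big_seq; apply: eq_bigr => w /size_words wn.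
transitivity (\sum_i \sum_j p (i :: rcons w j) * \1_E (extend n w)).
  apply: eq_bigr => i _; apply: eq_bigr => j _; congr (_ * _).
  rewrite !indicE; congr (_%:R); congr nat_of_bool.
  by apply: asbool_equiv_eq; rewrite (window_setE En (agree_extendS i j wn)).
rewrite exchange_big /= -{1}(p_rcons w) mulr_suml; apply: eq_bigr => j _.
by rewrite -mulr_suml p_cons.
Qed.

Lemma window_weightW m n E : (m <= n)%N -> window_set m E ->
  window_weight n E = window_weight m E.
Proof.
move=> + Em; elim: n => [|n ih]; first by rewrite leqn0 => /eqP ->.
rewrite leq_eqVlt => /predU1P[-> //|]; rewrite ltnS => mn.
by rewrite window_weightS ?ih//; exact: window_setW mn Em.
Qed.

(** [xget] picks any window that determines [E]. *)
Definition local_weight (E : set (local_space M)) : \bar R :=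
  (window_weight (xget 0%N [set n | window_set n E]) E)%:E.

Lemma local_weightE n E : window_set n E -> local_weight E = (window_weight n E)%:E.
Proof.
move=> En; congr (_%:E); set m := xget _ _.
have Em : window_set m E by apply: (@xgetPex _ 0%N [set n | window_set n E]); exists n.
case: (leqP m n) => [mn|/ltnW nm]; last exact: window_weightW.
by apply/esym/window_weightW.
Qed.

Lemma local_weight_ge0 E : (0 <= local_weight E)%E.
Proof.
by rewrite lee_fin; apply: sumr_ge0 => w _; rewrite mulr_ge0// indicE.
Qed.

Lemma local_weight0 : local_weight set0 = 0%E.
Proof.
rewrite /local_weight /window_weight big1// => w _.
by rewrite indicE in_set0 mulr0.
Qed.

Lemma local_weight_additive : measure_function.semi_additive local_weight.
Proof.
apply/(additive2P local_weight0) => E F [m Em] [n Fn] EF0.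
pose k := maxn m n.
have Ek : window_set k E by apply: window_setW Em; exact: leq_maxl.
have Fk : window_set k F by apply: window_setW Fn; exact: leq_maxr.
have EFk : window_set k (E `|` F).
  by move=> x y xy [/(Ek _ _ xy)|/(Fk _ _ xy)]; [left|right].
rewrite !(@local_weightE k)// -EFinD -big_split /=; congr (_%:E).
apply: eq_bigr => w _; rewrite -mulrDr !indicE in_setU.
case: (boolP (_ \in E)) => wE; last by rewrite /= add0r.
case: (boolP (_ \in F)) => wF; last by rewrite /= addr0.
by rewrite !inE in wE wF; have : set0 (extend k w) by rewrite -EF0.
Qed.

HB.instance Definition _ := isContent.Build _ (local_space M) R local_weight
  local_weight_ge0 local_weight_additive.

(** Compactness reduces a countable cover of a clopen set to a finite one, so
    countable subadditivity comes for free. *)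
Lemma local_weight_sigma_subadditive :
  measurable_subset_sigma_subadditive local_weight.
Proof.
move=> E F mF mE EF; have mF' n : local_set (F n) by exact: mF.
have cE : compact (E : set (fullshift M)).
  apply: (@subclosed_compact _ _ setT) => //; last exact: fullshift_compact.
  by rewrite -openC; apply/local_set_open/local_setC.
have : cover_compact (E : set (fullshift M)) by rewrite -compact_cover.
move=> /(_ nat setT F) => -[n _|x Ex|D _ ED].
- exact: local_set_open.
- by have [n _ Fx] := EF x Ex; exists n.
pose N := (\max_(i <- finmap.enum_fset D) i).+1.
have EN : E `<=` \big[setU/set0]_(i < N) F i.
  move=> x /ED[i iD Fx]; rewrite -bigcup_mkord; exists i => //=.
  by rewrite /N ltnS; apply: (@leq_bigmax_seq _ _ xpredT id).
apply: (@le_trans _ _ (\sum_(i < N) local_weight (F i))%E).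
  by apply: (@content_subadditive _ _ _ local_weight) => // k _; exact: mF.
rewrite -(big_mkord xpredT (fun i => local_weight (F i))).
by apply: nneseries_lim_ge => k _ _; exact: local_weight_ge0.
Qed.

HB.instance Definition _ := Content_SigmaSubAdditive_isMeasure.Build
  _ R (local_space M) local_weight local_weight_sigma_subadditive.

Let ext : set (fullshift M) -> \bar R := measure_extension local_weight.

Let ext0 : ext set0 = 0%E. Proof. exact: measure0. Qed.
Let ext_ge0 E : (0 <= ext E)%E. Proof. exact: measure_ge0. Qed.

Let ext_sigma_additive : measure_function.semi_sigma_additive ext.
Proof.
move=> F mF tF mUF; apply: (@measure_semi_sigma_additive _ _ _
  (measure_extension local_weight)) => //.
- by move=> i; have := mF i; rewrite measurable_local.
- by move: mUF; rewrite measurable_local.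
Qed.

HB.instance Definition _ := isMeasure.Build _ (fullshift M) R ext
  ext0 ext_ge0 ext_sigma_additive.

Let ext_local E : local_set E -> ext E = local_weight E.
Proof. by move=> lE; rewrite /ext /measure_extension /= measurable_mu_extE. Qed.

Let ext_setT : ext setT = 1%E.
Proof.
rewrite ext_local ?(@local_weightE 0)//; last exact: local_setT.
by rewrite /window_weight sum_words0 p_nil indicE in_setT mulr1.
Qed.

HB.instance Definition _ := Measure_isProbability.Build _ _ _ ext ext_setT.

Lemma sum_prefix n w : \sum_(v <- words M n) p (v ++ w) = p w.
Proof.
elim: n => [|n ih]; first by rewrite sum_words0.
rewrite sum_words_cons exchange_big /= -[RHS]ih.
by apply: eq_bigr => v _; rewrite -p_cons.
Qed.

Lemma sum_suffix n w : \sum_(v <- words M n) p (w ++ v) = p w.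
Proof.
elim: n => [|n ih]; first by rewrite sum_words0 cats0.
rewrite sum_words_rcons -[RHS]ih; apply: eq_bigr => v _.
by rewrite -[RHS]p_rcons; apply: eq_bigr => i _; rewrite rcons_cat.
Qed.

(** Split a window containing the cylinder into the letters before, on and after
    it; the outer letters sum out by consistency. *)
Let ext_cyl a w : ext (cyl a w) = (p w)%:E.
Proof.
rewrite ext_local; last exact: local_cyl.
pose n := (absz a + size w)%N.
have [k [k' [akn knk]]] : exists k k' : nat,
   (a = - n%:Z + k%:Z)%R /\ (k + (size w + k') = n.*2)%N.
  by exists (absz (a + n%:Z)), (absz ((absz a)%:Z - a)); rewrite /n; lia.
rewrite (local_weightE (@window_cyl _ a w)) -/n; congr (_%:E).
rewrite /window_weight -knk sum_words_cat.
transitivity (\sum_(v <- words M k) p (v ++ w)); last exact: sum_prefix.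
rewrite big_seq [RHS]big_seq; apply: eq_bigr => v /size_words vk.
rewrite sum_words_cat exchange_big /= -[RHS](sum_suffix k').
rewrite big_seq [RHS]big_seq; apply: eq_bigr => v' /size_words v'k.
rewrite -[RHS](sum_words_delta (fun y => p ((v ++ y) ++ v'))).
rewrite big_seq [RHS]big_seq; apply: eq_bigr => y /size_words yw.
have yE : (extend n (v ++ y ++ v') \in cyl a w) = (y == w).
  have : block (extend n (v ++ y ++ v')) (- n%:Z) n.*2 = v ++ y ++ v'.
    by apply: block_extend; rewrite !size_cat vk yw v'k knk.
  rewrite -knk block_cat block_cat -akn => /eqP.
  rewrite eqseq_cat ?size_block// => /andP[_].
  rewrite eqseq_cat ?size_block// => /andP[/eqP yE _].
  by apply/idP/eqP; rewrite inE /cyl /= yE.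
rewrite indicE yE; case: ifP => _; last by rewrite mulr0.
by rewrite mulr1 catA.
Qed.

Theorem word_measure : exists mu : probability (fullshift M) R,
  forall a w, mu (cyl a w) = (p w)%:E.
Proof.
by exists [the probability (fullshift M) R of ext]; exact: ext_cyl.
Qed.

End WordMeasure.

(** * Integration of bounded functions *)

Section BoundedFunctions.
Context {R : realType} d (T : measurableType d).
Implicit Types f g : T -> R.

Definition bounded_mfun f : Prop :=
  measurable_fun [set: T] f /\ exists b, forall x, `|f x| <= b.

Lemma bounded_mfun_cst (c : R) : bounded_mfun (fun=> c).
Proof. by split; [exact: measurable_cst|exists `|c|]. Qed.

Lemma bounded_mfunD f g : bounded_mfun f -> bounded_mfun g ->
  bounded_mfun (fun x => f x + g x).
Proof.
move=> [mf [b fb]] [mg [c gc]]; split; first exact: measurable_funD.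
by exists (b + c) => x; rewrite (le_trans (ler_normD _ _))// lerD.
Qed.

Lemma bounded_mfunM f g : bounded_mfun f -> bounded_mfun g ->
  bounded_mfun (fun x => f x * g x).
Proof.
move=> [mf [b fb]] [mg [c gc]]; split; first exact: measurable_funM.
by exists (b * c) => x; rewrite normrM ler_pM.
Qed.

Lemma bounded_mfunZ (c : R) f : bounded_mfun f -> bounded_mfun (fun x => c * f x).
Proof. exact/bounded_mfunM/bounded_mfun_cst. Qed.

Lemma bounded_mfunB f g : bounded_mfun f -> bounded_mfun g ->
  bounded_mfun (fun x => f x - g x).
Proof.
move=> bf bg; under eq_fun do rewrite -mulN1r.
by apply: bounded_mfunD => //; exact: bounded_mfunZ.
Qed.

Lemma bounded_mfun_sum (J : Type) (s : seq J) (F : J -> T -> R) :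
  (forall j, bounded_mfun (F j)) -> bounded_mfun (fun x => \sum_(j <- s) F j x).
Proof.
move=> bF; elim: s => [|j s ih].
  by under eq_fun do rewrite big_nil; exact: bounded_mfun_cst.
by under eq_fun do rewrite big_cons; exact: bounded_mfunD.
Qed.

Lemma bounded_mfun_indic (E : set T) : measurable E ->
  bounded_mfun (\1_E : T -> R).
Proof.
move=> mE; split; first exact: measurable_indic.
by exists 1 => x; rewrite indicE ger0_norm//; case: (_ \in _).
Qed.

Variables (nu : {measure set T -> \bar R}).
Hypothesis nu_fin : (nu setT < +oo)%E.

Lemma bounded_mfun_integrable f : bounded_mfun f ->
  nu.-integrable setT (EFin \o f).
Proof.
move=> [mf [b fb]]; apply: measurable_bounded_integrable => //.
exists b; split=> [|c bc x _]; first exact: num_real.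
exact: le_trans (fb x) (ltW bc).
Qed.

Lemma Rintegral_sum (J : Type) (s : seq J) (F : J -> T -> R) :
  (forall j, bounded_mfun (F j)) ->
  \int[nu]_x (\sum_(j <- s) F j x) = \sum_(j <- s) \int[nu]_x F j x.
Proof.
move=> bF; elim: s => [|j s ih].
  under eq_Rintegral do rewrite big_nil.
  by rewrite big_nil Rintegral_cst// mul0r.
under eq_Rintegral do rewrite big_cons.
rewrite RintegralD ?big_cons ?ih//; apply: bounded_mfun_integrable => //.
exact: bounded_mfun_sum.
Qed.

Lemma Rintegral_indic (E : set T) : measurable E ->
  \int[nu]_x (\1_E x : R) = fine (nu E).
Proof. by move=> mE; rewrite /Rintegral integral_indic// setIT. Qed.

Lemma Rintegral_step (J : Type) (s : seq J) (c : J -> R) (E : J -> set T) :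
  (forall j, measurable (E j)) ->
  \int[nu]_x (\sum_(j <- s) c j * \1_(E j) x) = \sum_(j <- s) c j * fine (nu (E j)).
Proof.
move=> mE; rewrite Rintegral_sum => [|j]; last first.
  exact/bounded_mfunZ/bounded_mfun_indic.
apply: eq_bigr => j _; rewrite RintegralZl ?Rintegral_indic//.
exact/bounded_mfun_integrable/bounded_mfun_indic.
Qed.

Lemma fin_measure E : measurable E -> nu E = (fine (nu E))%:E.
Proof.
move=> mE; rewrite fineK// ge0_fin_numE ?measure_ge0//.
by apply: le_lt_trans nu_fin; apply: le_measure; rewrite ?inE.
Qed.

(** Splitting at the level [l] bounds the first moment by the second. *)
Lemma Rintegral_second_moment f (l : R) : bounded_mfun f -> 0 < l ->
  `|\int[nu]_x f x| <= l * fine (nu setT) + l^-1 * \int[nu]_x (f x * f x).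
Proof.
move=> bf l0; have if_ := bounded_mfun_integrable bf.
have bff := bounded_mfunM bf bf.
apply: (le_trans (le_normr_Rintegral measurableT if_)).
rewrite -(Rintegral_cst nu measurableT) -RintegralZl//; last first.
  exact: bounded_mfun_integrable.
rewrite -RintegralD//; first last.
- exact/bounded_mfun_integrable/bounded_mfunZ.
- exact/bounded_mfun_integrable/bounded_mfun_cst.
apply: le_Rintegral => //.
- exact: integrable_norm.
- apply/bounded_mfun_integrable/bounded_mfunD; first exact: bounded_mfun_cst.
  exact: bounded_mfunZ.
move=> x _; rewrite -expr2 -real_normK ?num_real//.
have [fl|/ltW lf] := leP `|f x| l.
  by rewrite (le_trans fl)// lerDl mulr_ge0// ?invr_ge0 ?(ltW l0)// sqr_ge0.
rewrite ler_wpDl// ?(ltW l0)// ler_pdivlMl// expr2.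
by rewrite ler_wpM2r.
Qed.

End BoundedFunctions.

(** * Measures on the full shift are determined by cylinders *)

Section Cylinders.
Context {R : realType} {M : nat}.
Local Notation I := 'I_M.+1.
Local Notation X := (fullshift M).
Implicit Types (f g : X -> R) (w : seq I).

Lemma measurable_cyl a w : measurable (cyl a w).
Proof. by apply: local_measurable; exact: local_cyl. Qed.

Lemma sum_cyl_indic (F : seq I -> R) a n (x : X) :
  \sum_(w <- words M n) F w * \1_(cyl a w) x = F (block x a n).
Proof.
rewrite -[RHS]sum_words_delta size_block big_seq [RHS]big_seq.
apply: eq_bigr => w /size_words wn; rewrite indicE.
have -> : (x \in cyl a w) = (w == block x a n).
  by rewrite eq_sym; apply/idP/eqP; rewrite inE /cyl /= wn.
by case: ifP => _; rewrite ?mulr1 ?mulr0.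
Qed.

Definition window_fun (n : nat) f : Prop := forall x y, agree n x y -> f x = f y.

Lemma window_fun_step n f (x : X) : window_fun n f ->
  f x = \sum_(w <- words M n.*2) f (extend n w) * \1_(cyl (- n%:Z) w) x.
Proof.
move=> fn; rewrite (sum_cyl_indic (f \o extend n)); apply: fn.
by apply/agree_extend; rewrite ?size_block//= /cyl /= size_block.
Qed.

Lemma window_fun_bounded n f : window_fun n f -> bounded_mfun f.
Proof.
move=> fn; rewrite (funext (fun x => window_fun_step x fn)).
apply: bounded_mfun_sum => w; apply: bounded_mfunZ.
by apply: bounded_mfun_indic; exact: measurable_cyl.
Qed.

Lemma window_fun_indic n E : window_set n E -> window_fun n (\1_E).
Proof.
move=> En x y xy; rewrite !indicE; congr (_%:R); congr nat_of_bool.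
by apply: asbool_equiv_eq; rewrite (window_setE En xy).
Qed.

Lemma window_funM n f g : window_fun n f -> window_fun n g ->
  window_fun n (fun x => f x * g x).
Proof. by move=> fn gn x y xy; rewrite (fn x y)// (gn x y). Qed.

Section Finite.
Variable nu : {measure set X -> \bar R}.
Hypothesis nu_fin : (nu setT < +oo)%E.

Lemma Rintegral_window n f : window_fun n f ->
  \int[nu]_x f x =
  \sum_(w <- words M n.*2) f (extend n w) * fine (nu (cyl (- n%:Z) w)).
Proof.
move=> fn; under eq_Rintegral do rewrite (window_fun_step _ fn).
by apply: Rintegral_step => // w; exact: measurable_cyl.
Qed.

Lemma measure_cyl_split a n E : measurable E ->
  fine (nu E) = \sum_(w <- words M n) fine (nu (E `&` cyl a w)).
Proof.
move=> mE; rewrite -(Rintegral_indic nu mE).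
transitivity (\int[nu]_x (\sum_(w <- words M n) 1 * \1_(E `&` cyl a w) x) : R).
  apply: eq_Rintegral => x _.
  rewrite (eq_bigr (fun w => \1_E x * \1_(cyl a w) x)).
    by rewrite (sum_cyl_indic (fun=> \1_E x)).
  by move=> w _; rewrite indicI mul1r.
rewrite Rintegral_step//; first by apply: eq_bigr => w _; rewrite mul1r.
by move=> w; apply: measurableI => //; exact: measurable_cyl.
Qed.

End Finite.

(** Local sets form a generating algebra, and the mass of a local set is a finite
    sum of masses of cylinders. *)
Lemma measure_cyl_unique (mu nu : {measure set X -> \bar R}) :
  (mu setT < +oo)%E -> (nu setT < +oo)%E ->
  (forall a w, fine (mu (cyl a w)) = fine (nu (cyl a w))) ->
  forall E, measurable E -> mu E = nu E.
Proof.
move=> muf nuf munu E mE.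
apply: (measure_unique (@local_set M) (fun=> setT)) mE => //.
- exact: measurable_local.
- by move=> A B; exact: local_setI.
- by move=> _; exact: local_setT.
- by rewrite bigcup_const//; exists 0%N.
move=> A lA; have mA := local_measurable lA; have [n An] := lA.
rewrite (fin_measure muf mA) (fin_measure nuf mA); congr (_%:E).
rewrite -(Rintegral_indic mu mA) -(Rintegral_indic nu mA).
rewrite (Rintegral_window muf (window_fun_indic An)).
rewrite (Rintegral_window nuf (window_fun_indic An)).
by apply: eq_bigr => w _; rewrite munu.
Qed.

Lemma measurable_shift : measurable_fun setT (@shift_map M).
Proof.
apply: (measurability (@local_set M)) => [|_ [E lE <-]]; first exact: measurable_local.
by rewrite setTI; apply: local_measurable; exact: local_shift.
Qed.

Lemma measurable_iter_shift n : measurable_fun setT (iter n (@shift_map M)).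
Proof.
elim: n => [|n ih]; first exact: measurable_id.
exact: (measurableT_comp measurable_shift ih).
Qed.

Lemma cyl_shift1 a w : @shift_map M @^-1` cyl a w = cyl (a + 1) w.
Proof. exact: (cyl_shift a 1 w). Qed.

Lemma shift_invariant_cyl (mu : probability X R) :
  (forall a w, fine (mu (cyl (a + 1) w)) = fine (mu (cyl a w))) ->
  shift_invariant mu.
Proof.
move=> muS E mE.
rewrite -[LHS]/(pushforward mu (@shift_map M) E).
apply: (measure_cyl_unique (mu := pushforward mu _)) mE => //=.
- exact: measurable_shift.
- move=> mS; rewrite /pushforward preimage_setT probability_setT.
  exact: ltry.
- by rewrite probability_setT ltry.
- by move=> ? a w; rewrite /pushforward cyl_shift1 muS.
Qed.

Lemma cyl_invariant (nu : {measure set X -> \bar R}) :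
  (forall E, measurable E -> nu (@shift_map M @^-1` E) = nu E) ->
  forall a w, nu (cyl a w) = nu (cyl 0 w).
Proof.
move=> nuS a w; have S1 b : nu (cyl (b + 1) w) = nu (cyl b w).
  by rewrite -cyl_shift1 nuS//; exact: measurable_cyl.
elim/int_rect: a => [//|n ih|n ih]; first by rewrite -addn1 PoszD S1.
by rewrite -S1 -addn1 PoszD opprD subrK.
Qed.

(** * Uniqueness through decay of averaged correlations *)

(** If the correlations of the cylinder of [w] with its translates add up to
    at most linear growth, ergodic averages of its indicator converge in mean
    square under [mu], hence under any invariant [nu] dominated by [mu] on
    cylinders; so both give it the same relative mass. *)
Section Domination.
Variables (mu nu : {measure set X -> \bar R}) (C0 : R).
Hypotheses (mu_fin : (mu setT < +oo)%E) (nu_fin : (nu setT < +oo)%E).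
Hypotheses (muS : forall E, measurable E -> mu (@shift_map M @^-1` E) = mu E)
  (nuS : forall E, measurable E -> nu (@shift_map M @^-1` E) = nu E).
Hypotheses (mu1 : mu setT = 1%E) (C0_ge0 : 0 <= C0).
Hypothesis dom : forall a w, fine (nu (cyl a w)) <= C0 * fine (mu (cyl a w)).

Lemma Rintegral_dominated n f : window_fun n f -> (forall x, 0 <= f x) ->
  \int[nu]_x f x <= C0 * \int[mu]_x f x.
Proof.
move=> fn f0; rewrite !(Rintegral_window _ fn)// mulr_sumr.
apply: ler_sum => w _; rewrite mulrCA ler_wpM2l//.
Qed.

Variables (w : seq I) (L : R).
Hypothesis cor : forall N, \sum_(i < N) \sum_(j < N)
  (fine (mu (cyl i%:Z w `&` cyl j%:Z w)) - fine (mu (cyl 0 w)) ^+ 2) <= L * N%:R.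

Let c := fine (mu (cyl 0 w)).
Let birkhoff N (x : X) : R := \sum_(i < N) (\1_(cyl i%:Z w) x - c).

Let birkhoff_window N : exists n, window_fun n (birkhoff N).
Proof.
exists (N + size w)%N => x y xy; apply: eq_bigr => i _; congr (_ - _).
apply: (@window_fun_indic (absz i + size w)); first exact: window_cyl.
apply: agreeW xy; rewrite absz_nat; have := ltn_ord i; lia.
Qed.

Lemma birkhoff_mean N :
  \int[nu]_x birkhoff N x = (fine (nu (cyl 0 w)) - c * fine (nu setT)) * N%:R.
Proof.
have bi a : bounded_mfun (\1_(cyl a w) : X -> R).
  by apply: bounded_mfun_indic; exact: measurable_cyl.
rewrite Rintegral_sum// => [|i]; last first.
  by apply: bounded_mfunB => //; exact: bounded_mfun_cst.
rewrite -[LHS]addr0 -[X in _ + X](mul0r N%:R).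
rewrite (eq_bigr (fun=> fine (nu (cyl 0 w)) - c * fine (nu setT))).
  by rewrite sumr_const card_ord mul0r addr0 mulr_natr.
move=> i _; rewrite RintegralB//.
- rewrite Rintegral_cst// Rintegral_indic ?cyl_invariant//.
  exact: measurable_cyl.
- exact: bounded_mfun_integrable.
- exact/bounded_mfun_integrable/bounded_mfun_cst.
Qed.

Lemma birkhoff_variance N :
  \int[mu]_x (birkhoff N x * birkhoff N x) <= L * N%:R.
Proof.
apply: le_trans (cor N); rewrite le_eqVlt; apply/orP; left; apply/eqP.
have bi a : bounded_mfun (\1_(cyl a w) : X -> R).
  by apply: bounded_mfun_indic; exact: measurable_cyl.
have bc (a : R) : @bounded_mfun R _ X (fun=> a) by exact: bounded_mfun_cst.
have bic a : bounded_mfun (fun x => \1_(cyl a w) x - c : R) by exact: bounded_mfunB.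
under eq_Rintegral do rewrite /birkhoff big_distrlr /=.
rewrite Rintegral_sum// => [|i]; last first.
  by apply: bounded_mfun_sum => j; exact: bounded_mfunM.
apply: eq_bigr => i _; rewrite Rintegral_sum// => [|j]; last exact: bounded_mfunM.
apply: eq_bigr => j _.
have mI : measurable (cyl i%:Z w `&` cyl j%:Z w).
  by apply: measurableI; exact: measurable_cyl.
have bI := @bounded_mfun_indic R _ _ _ mI.
transitivity (\int[mu]_x ((\1_(cyl i%:Z w `&` cyl j%:Z w) x + c ^+ 2) -
   (c * \1_(cyl i%:Z w) x + c * \1_(cyl j%:Z w) x)) : R).
  by apply: eq_Rintegral => x _; rewrite indicI /=; ring.
have bint := bounded_mfun_integrable mu_fin.
have bZ a : bounded_mfun (fun x => c * \1_(cyl a w) x : R) by exact: bounded_mfunZ.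
rewrite RintegralB//; [|exact/bint/bounded_mfunD|exact/bint/bounded_mfunD].
rewrite !RintegralD//; do ?[exact: bint].
rewrite !RintegralZl//; do ?[exact: bint].
rewrite Rintegral_cst// !Rintegral_indic//; do ?[exact: measurable_cyl].
rewrite !(cyl_invariant muS) mu1 -/c /=; ring.
Qed.

(** With averages over [m ^ 2] steps and splitting level [m], the second moment
    estimate reads [|difference| * m <= constant], for every [m]. *)
Lemma dominated_cyl : fine (nu (cyl 0 w)) = c * fine (nu setT).
Proof.
apply/eqP; rewrite -subr_eq0; set dl := _ - _.
have main m : (0 < m)%N -> `|dl| * m%:R <= fine (nu setT) + C0 * L.
  move=> m0; have [n bw] := birkhoff_window (m * m).
  have m0' : 0 < m%:R :> R by rewrite ltr0n.
  have bb := window_fun_bounded bw.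
  have := Rintegral_second_moment nu_fin bb m0'.
  rewrite birkhoff_mean -/dl normrM natrM [`|m%:R * _|]ger0_norm//.
  have V : \int[nu]_x (birkhoff (m * m) x * birkhoff (m * m) x) <= C0 * (L * (m%:R * m%:R)).
    apply: le_trans (Rintegral_dominated (window_funM bw bw) _) _.
      by move=> x; rewrite -expr2 sqr_ge0.
    by rewrite ler_wpM2l// -natrM birkhoff_variance.
  move=> h; rewrite -(ler_pM2r m0') -mulrA (le_trans h)//.
  rewrite mulrDl mulrC lerD2l (le_trans (ler_wpM2l _ V)) ?invr_ge0//.
  rewrite le_eqVlt; apply/orP; left; apply/eqP; field; exact: lt0r_neq0.
apply/eqP; apply: contrapT => /eqP dl0.
have nd : 0 < `|dl| by rewrite normr_gt0.
have := main (Num.truncn ((fine (nu setT) + C0 * L) / `|dl|)).+1 isT.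
rewrite mulrC -ler_pdivlMr// leNgt truncnS_gt//.
Qed.

End Domination.
End Cylinders.

(** * Ergodicity *)

Section Ergodic.
Context {R : realType} {M : nat}.
Local Notation I := 'I_M.+1.
Local Notation X := (fullshift M).
Variable mu : probability X R.
Hypothesis muS : shift_invariant mu.
Hypothesis cor : forall w, exists L : R, forall N, \sum_(i < N) \sum_(j < N)
  (fine (mu (cyl i%:Z w `&` cyl j%:Z w)) - fine (mu (cyl 0 w)) ^+ 2) <= L * N%:R.

Let mu_fin : (mu setT < +oo)%E. Proof. by rewrite probability_setT ltry. Qed.

(** [dominated_cyl] gives proportionality on cylinders, and cylinders determine
    measures. *)
Lemma dominated_proportional (nu : {measure set X -> \bar R}) (C0 : R) :
  (nu setT < +oo)%E ->
  (forall E, measurable E -> nu (@shift_map M @^-1` E) = nu E) ->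
  0 <= C0 -> (forall a w, fine (nu (cyl a w)) <= C0 * fine (mu (cyl a w))) ->
  forall E, measurable E -> fine (nu E) = fine (mu E) * fine (nu setT).
Proof.
move=> nuf nuS C00 dom E mE.
have nuT0 : 0 <= fine (nu setT) by rewrite fine_ge0.
pose mu' := mscale (NngNum nuT0) mu.
have mu'E A : measurable A -> fine (mu' A) = fine (mu A) * fine (nu setT).
  move=> mA; rewrite /mu' /mscale /= fineM ?fin_num_measure// mulrC.
  by [].
rewrite -mu'E//; congr fine; apply: measure_cyl_unique => //.
  rewrite -[ltLHS]/((fine (nu setT))%:E * mu setT)%E probability_setT mule1.
  exact: ltry.
move=> a w; rewrite mu'E; last exact: measurable_cyl.
rewrite !cyl_invariant//; have [L corL] := cor w.
exact: (dominated_cyl mu_fin nuf muS nuS (probability_setT mu) C00 dom corL).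
Qed.

(** For an invariant set [B], the restriction of [mu] to [B] is invariant and
    dominated by [mu], hence proportional to it; evaluating at the complement of
    [B] gives [mu B * mu (~ B) = 0]. *)
Lemma invariant_trivial : ergodic mu.
Proof.
split=> // B mB BB.
pose nu := mrestr mu mB.
have nuE E : nu E = mu (E `&` B) by [].
have nu_le E : measurable E -> (nu E <= mu E)%E.
  move=> mE; rewrite nuE; apply: le_measure; rewrite ?inE//.
  exact: measurableI.
have nuf : (nu setT < +oo)%E.
  by apply: le_lt_trans mu_fin; exact: nu_le.
have nuS E : measurable E -> nu (@shift_map M @^-1` E) = nu E.
  by move=> mE; rewrite !nuE -{1}BB -preimage_setI muS//; exact: measurableI.
have dom a w : fine (nu (cyl a w)) <= 1 * fine (mu (cyl a w)).
  have mC := @measurable_cyl M a w.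
  rewrite mul1r -lee_fin -(fin_measure nuf mC) -(fin_measure mu_fin mC).
  exact: nu_le.
have : fine (mu (~` B `&` B)) = fine (mu (~` B)) * fine (mu (setT `&` B)).
  exact: (dominated_proportional nuf nuS ler01 dom (measurableC mB)).
rewrite setICl measure0 setTI probability_setC//=.
have -> : fine (1 - mu B) = 1 - fine (mu B).
  by rewrite fineB// fin_num_measure.
move/eqP; rewrite eq_sym mulf_eq0 subr_eq0 => /orP[/eqP h|/eqP h]; [right|left].
  by rewrite (fin_measure mu_fin mB) -h.
by rewrite (fin_measure mu_fin mB) h.
Qed.

End Ergodic.

(** * Consequences of psi-mixing *)

(** The error in [mixing] is relative to the product of the masses; this is what
    makes it summable over all words, whatever their lengths. *)
Section Mixing.
Context {R : realType} {M : nat}.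
Local Notation I := 'I_M.+1.
Local Notation X := (fullshift M).
Variable mu : probability X R.
Hypothesis muS : shift_invariant mu.
Variables (D r : R).
Hypotheses (D_ge0 : 0 <= D) (r01 : 0 < r < 1).
Hypothesis mixing : forall a v g w,
  `|fine (mu (cyl a v `&` cyl (a + (size v)%:Z + g%:Z) w)) -
    fine (mu (cyl a v)) * fine (mu (cyl (a + (size v)%:Z + g%:Z) w))| <=
  D * r ^+ g * (fine (mu (cyl a v)) * fine (mu (cyl (a + (size v)%:Z + g%:Z) w))).

Let mu_fin : (mu setT < +oo)%E. Proof. by rewrite probability_setT ltry. Qed.

Lemma join_partition_cyl m s (q : {ffun 'I_s -> I}) :
  join_partition (@standard_partition M) m q = cyl m%:Z (codom q).
Proof.
apply/seteqP; split => x; rewrite /join_partition /standard_partition /cyl /=.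
  move=> xq; apply: (@eq_from_nth _ ord0); rewrite ?size_block// => k.
  rewrite size_codom card_ord => ks; rewrite nth_mkseq ?size_codom ?card_ord//.
  have := xq (Ordinal ks); rewrite /= iter_shift add0r PoszD => ->.
  rewrite (nth_map (Ordinal ks)) -?cardE ?card_ord//.
  by congr (q _); apply: val_inj; rewrite /= nth_enum_ord.
move=> xq k; have := congr1 (fun s => nth ord0 s k) xq.
have ks := ltn_ord k.
rewrite nth_mkseq ?size_codom ?card_ord// iter_shift add0r PoszD => ->.
rewrite (nth_map k) -?cardE ?card_ord//.
by congr (q _); apply: val_inj; rewrite /= nth_enum_ord.
Qed.

(** Each point lies in exactly one cell, that of the word it carries. *)
Lemma sum_join_partition m s : \sum_(q : {ffun 'I_s -> I})
  fine (mu (join_partition (@standard_partition M) m q)) = 1.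
Proof.
have mJ (q : {ffun 'I_s -> I}) :
    measurable (join_partition (@standard_partition M) m q).
  by rewrite join_partition_cyl; exact: measurable_cyl.
transitivity (\sum_(q : {ffun 'I_s -> I}) 1 *
    fine (mu (join_partition (@standard_partition M) m q))).
  by apply: eq_bigr => q _; rewrite mul1r.
rewrite -(Rintegral_step mu_fin)//.
rewrite -[RHS]/(fine 1%:E) -[1%:E in RHS](probability_setT mu) -[RHS]mul1r.
rewrite -Rintegral_cst//; apply: eq_Rintegral => x _.
pose q0 := [ffun k : 'I_s => (iter (m + k) (@shift_map M) x 0 : I)].
have qE q : (x \in join_partition (@standard_partition M) m q) = (q == q0).
  apply/idP/eqP; rewrite inE /join_partition /standard_partition /=.
    by move=> xq; apply/ffunP => k; rewrite ffunE xq.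
  by move=> -> k; rewrite ffunE.
rewrite (bigD1 q0)//= big1 => [|q qq0]; last by rewrite indicE qE (negPf qq0) mulr0.
by rewrite indicE qE eqxx mulr1 addr0.
Qed.

Lemma geometric_small (eps : R) : 0 < eps -> exists N : nat, D * r ^+ N < eps.
Proof.
move=> e0; case/andP: r01 => r0 r1.
have : (fun n => D * r ^+ n) @ \oo --> (0 : R).
  rewrite -[X in _ --> X](mulr0 D); apply: cvgMr; apply: cvg_expr.
  by rewrite gtr0_norm.
move/cvgrPdist_lt => /(_ _ e0)[N _ NP]; exists N.
by have := NP N (leqnn N); rewrite /= sub0r normrN; apply: le_lt_trans; exact: ler_norm.
Qed.

Lemma mixing_weak_bernoulli : weak_bernoulli mu.
Proof.
move=> eps e0; have [N NP] := geometric_small e0; exists N => r' s m sNm.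
case/andP: r01 => r0 r1.
rewrite /eps_indep; apply: le_lt_trans NP.
have -> : D * r ^+ N = \sum_(q : {ffun 'I_s -> I}) \sum_(q' : {ffun 'I_r' -> I})
   D * r ^+ N * (fine (mu (join_partition (@standard_partition M) 0 q)) *
     fine (mu (join_partition (@standard_partition M) m q'))).
  under eq_bigr do under eq_bigr do rewrite mulrA.
  under eq_bigr do rewrite -mulr_sumr sum_join_partition mulr1.
  by rewrite -mulr_sumr sum_join_partition mulr1.
apply: ler_sum => q _; apply: ler_sum => q' _.
rewrite !join_partition_cyl.
have mE : m%:Z = 0 + (size (codom q))%:Z + (m - s)%N%:Z.
  by rewrite size_codom card_ord; lia.
rewrite mE; apply: le_trans (mixing _ _ _ _) _.
rewrite ler_wpM2r//; first by rewrite mulr_ge0// fine_ge0.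
rewrite ler_wpM2l//; apply: ler_wiXn2l; rewrite ?(ltW r0) ?(ltW r1)//; lia.
Qed.


(** * Hölder functions *)

Lemma continuous_bounded_mfun (f : X -> R) : continuous f -> bounded_mfun f.
Proof.
move=> cf; split.
  apply: (measurability _ (RGenOInfty.measurableE R)) => //.
  move=> _ [_ [a ->] <-]; rewrite setTI; apply: sub_sigma_algebra.
  by move/continuousP : cf; apply; exact: interval_open.
have cT := @fullshift_compact M.
have [|c _ cmax] := @compact_EVT_max _ R (fun x => `|f x|) _ (ex_intro _ point Logic.I) cT.
  apply: continuous_subspaceT => x.
  exact: (@continuous_comp X R R f _ x (cf x) (@norm_continuous R R (f x))).
by exists `|f c| => x; apply: cmax; rewrite inE.
Qed.

Section Hoelder.
Variables (theta : R) (f : X -> R).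
Hypotheses (theta01 : 0 < theta < 1) (hf : holder theta f).

Let fb : exists b, forall x, `|f x| <= b.
Proof. by have [_] := continuous_bounded_mfun hf.1. Qed.

Lemma le_sup_norm x : `|f x| <= sup_norm f.
Proof.
apply: ub_le_sup; last by exists x.
by have [b fb'] := fb; exists b => _ [y _ <-].
Qed.

Lemma sup_norm_ge0 : 0 <= sup_norm f.
Proof. exact: le_trans (normr_ge0 _) (le_sup_norm point). Qed.

Lemma le_var k x y : agree k x y -> `|f x - f y| <= var_ k f.
Proof.
move=> xy; apply: ub_le_sup.
  have [b fb'] := fb; exists (b + b) => _ [z [t [_ ->]]].
  by rewrite (le_trans (ler_normB _ _))// lerD.
by exists x, y; split=> // i ik; apply: xy; lia.
Qed.

Lemma holder_seminorm_ge0 : 0 <= holder_seminorm theta f.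
Proof.
by apply: lb_le_inf => [|c [/ltW//]]; have [c fc] := hf.2; exists c.
Qed.

Lemma var_le_seminorm k : var_ k f <= holder_seminorm theta f * theta ^+ k.
Proof.
have /andP[t0 _] := theta01; have tk : 0 < theta ^+ k by rewrite exprn_gt0.
rewrite -ler_pdivrMr//; apply: lb_le_inf; first by have [c fc] := hf.2; exists c.
by move=> c [_ /(_ k)]; rewrite ler_pdivrMr.
Qed.

Definition truncate k (x : X) : R := f (extend k (block x (- k%:Z) k.*2)).

Lemma truncate_window k : window_fun k (truncate k).
Proof. by move=> x y /agree_block; rewrite /truncate => ->. Qed.

Lemma truncate_error k x :
  `|f x - truncate k x| <= holder_seminorm theta f * theta ^+ k.
Proof.
apply: le_trans (var_le_seminorm k); apply: le_var.
by apply/agree_extend; rewrite ?size_block// /cyl /= size_block.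
Qed.

End Hoelder.

Lemma Rintegral_le_sup (f : X -> R) b : bounded_mfun f -> (forall x, `|f x| <= b) ->
  `|\int[mu]_x f x| <= b.
Proof.
move=> bf fb; have if_ := bounded_mfun_integrable mu_fin bf.
apply: (le_trans (le_normr_Rintegral measurableT if_)).
rewrite -[leRHS]mulr1 -[1 in leRHS]/(fine 1%:E) -(probability_setT mu).
rewrite -(Rintegral_cst mu measurableT); apply: le_Rintegral => //.
- exact: integrable_norm.
- exact/bounded_mfun_integrable/bounded_mfun_cst.
Qed.

(** For functions of finitely many coordinates the correlation is a sum over
    pairs of separated cylinders, to which the mixing estimate applies. *)
Lemma window_correlation k n (f g : X -> R) (F G : R) :
  window_fun k f -> window_fun k g -> (k.*2 <= n)%N ->
  (forall x, `|f x| <= F) -> (forall x, `|g x| <= G) ->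
  `|correlation mu f g n| <= D * r ^+ (n - k.*2) * F * G.
Proof.
move=> fk gk kn fF gG; have /andP[r0 r1] := r01.
have mc := @measurable_cyl M.
pose T w := cyl (n%:Z - k%:Z) w : set X.
have gE x : g (iter n (@shift_map M) x) =
    \sum_(w <- words M k.*2) g (extend k w) * \1_(T w) x.
  rewrite (window_fun_step _ gk); apply: eq_bigr => w _; congr (_ * _).
  rewrite !indicE; congr (_%:R); congr nat_of_bool.
  by apply: asbool_equiv_eq; rewrite /T /cyl /= block_shift addrC.
have muT w : fine (mu (T w)) = fine (mu (cyl (- k%:Z) w)).
  by rewrite !(cyl_invariant muS).
rewrite /correlation (Rintegral_window mu_fin fk) (Rintegral_window mu_fin gk).
have -> : (\int[mu]_x (f x * g (iter n (@shift_map M) x)) : R) =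
    \sum_(v <- words M k.*2) \sum_(w <- words M k.*2)
      f (extend k v) * g (extend k w) * fine (mu (cyl (- k%:Z) v `&` T w)).
  transitivity (\int[mu]_x (\sum_(v <- words M k.*2) \sum_(w <- words M k.*2)
      (f (extend k v) * g (extend k w)) * \1_(cyl (- k%:Z) v `&` T w) x) : R).
    apply: eq_Rintegral => x _; rewrite gE {1}(window_fun_step _ fk) big_distrlr /=.
    by apply: eq_bigr => v _; apply: eq_bigr => w _; rewrite indicI /=; ring.
  rewrite Rintegral_sum// => [|v]; last first.
    apply: bounded_mfun_sum => w; apply: bounded_mfunZ; apply: bounded_mfun_indic.
    by apply: measurableI; exact: mc.
  by apply: eq_bigr => v _; rewrite Rintegral_step// => w; apply: measurableI; exact: mc.
rewrite big_distrlr /= -sumrB.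
have mass : \sum_(w <- words M k.*2) fine (mu (cyl (- k%:Z) w)) = 1.
  rewrite -[RHS]/(fine 1%:E) -(probability_setT mu).
  rewrite (measure_cyl_split mu_fin (- k%:Z) k.*2)//.
  by apply: eq_bigr => w _; rewrite setTI.
have -> : D * r ^+ (n - k.*2) * F * G =
    \sum_(v <- words M k.*2) \sum_(w <- words M k.*2) D * r ^+ (n - k.*2) * F * G *
      (fine (mu (cyl (- k%:Z) v)) * fine (mu (cyl (- k%:Z) w))).
  under eq_bigr do under eq_bigr do rewrite mulrA.
  under eq_bigr do rewrite -mulr_sumr mass mulr1.
  by rewrite -mulr_sumr mass mulr1.
rewrite (le_trans (ler_norm_sum _ _ _))// big_seq [leRHS]big_seq ler_sum// => v vk.
rewrite -sumrB (le_trans (ler_norm_sum _ _ _))// ler_sum// => w _.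
rewrite mulrACA -mulrBr normrM.
have F0 : 0 <= F := le_trans (normr_ge0 _) (fF point).
have G0 : 0 <= G := le_trans (normr_ge0 _) (gG point).
have -> : D * r ^+ (n - k.*2) * F * G *
    (fine (mu (cyl (- k%:Z) v)) * fine (mu (cyl (- k%:Z) w))) = (F * G) *
    (D * r ^+ (n - k.*2) * (fine (mu (cyl (- k%:Z) v)) * fine (mu (cyl (- k%:Z) w)))).
  by ring.
rewrite ler_pM//; first by rewrite normrM ler_pM.
rewrite -!muT; have TE : n%:Z - k%:Z = - k%:Z + (size v)%:Z + (n - k.*2)%N%:Z.
  by rewrite (size_words vk); lia.
by rewrite {1 2 4 5}/T TE muT; have := mixing (- k%:Z) v (n - k.*2) w; rewrite -TE -/(T w) !muT.
Qed.

(** Replacing each function by an approximation changes each of the two terms of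
    the correlation by at most [e * G + F * e']. *)
Lemma correlation_perturb (f f' g g' : X -> R) (F G e e' : R) n :
  bounded_mfun f -> bounded_mfun f' -> bounded_mfun g -> bounded_mfun g' ->
  (forall x, `|f' x| <= F) -> (forall x, `|g x| <= G) ->
  (forall x, `|f x - f' x| <= e) -> (forall x, `|g x - g' x| <= e') ->
  `|correlation mu f g n - correlation mu f' g' n| <= 2 * (e * G + F * e').
Proof.
move=> bf bf' bg bg' f'F gG ff' gg'.
have F0 : 0 <= F := le_trans (normr_ge0 _) (f'F point).
have G0 : 0 <= G := le_trans (normr_ge0 _) (gG point).
have e0 : 0 <= e := le_trans (normr_ge0 _) (ff' point).
have e0' : 0 <= e' := le_trans (normr_ge0 _) (gg' point).
have bint := bounded_mfun_integrable mu_fin.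
have bs (u : X -> R) : bounded_mfun u -> bounded_mfun (fun x => u (iter n (@shift_map M) x)).
  move=> [mu' [b ub]]; split; last by exists b.
  exact: (measurableT_comp mu' (measurable_iter_shift n)).
have -> : correlation mu f g n - correlation mu f' g' n =
   ((\int[mu]_x (f x * g (iter n (@shift_map M) x))) -
    (\int[mu]_x (f' x * g' (iter n (@shift_map M) x)))) +
   ((\int[mu]_x f' x) * (\int[mu]_x g' x) - (\int[mu]_x f x) * (\int[mu]_x g x)).
  by rewrite /correlation; ring.
rewrite mulrDl mul1r.
apply: (le_trans (ler_normD _ _)); apply: lerD.
  rewrite -RintegralB//; [|exact/bint/bounded_mfunM/bs|exact/bint/bounded_mfunM/bs].
  apply: Rintegral_le_sup => [|x].
    by apply: bounded_mfunB; apply: bounded_mfunM => //; exact: bs.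
  set y := iter n _ x.
  have -> : f x * g y - f' x * g' y = (f x - f' x) * g y + f' x * (g y - g' y) by ring.
  by rewrite (le_trans (ler_normD _ _))// !normrM lerD// ler_pM.
have -> : (\int[mu]_x f' x) * (\int[mu]_x g' x) - (\int[mu]_x f x) * (\int[mu]_x g x) =
  - (((\int[mu]_x f x) - (\int[mu]_x f' x)) * (\int[mu]_x g x) +
     (\int[mu]_x f' x) * ((\int[mu]_x g x) - (\int[mu]_x g' x))) by ring.
rewrite normrN (le_trans (ler_normD _ _))// !normrM lerD// ler_pM//.
- rewrite -RintegralB//; [|exact: bint|exact: bint].
  by apply: Rintegral_le_sup => //; exact: bounded_mfunB.
- exact: Rintegral_le_sup.
- exact: Rintegral_le_sup.
- rewrite -RintegralB//; [|exact: bint|exact: bint].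
  by apply: Rintegral_le_sup => //; exact: bounded_mfunB.
Qed.

(** With windows of radius [n / 4] both the truncation error [theta ^ (n / 4)]
    and the mixing term [r ^ (n / 2)] are at most [m ^ (n / 4)] for
    [m = max theta r]; Bernoulli's inequality turns the fourth root of [m] into
    the rational expression below. *)
Definition decay_rate (theta s : R) : R := 1 - (1 - Num.max theta s) / 4.

Lemma decay_rate_bounds (theta s : R) : 0 < theta < 1 -> 0 < s < 1 ->
  0 < decay_rate theta s < 1.
Proof. by rewrite /decay_rate; case: (leP theta s); lra. Qed.

Lemma le_decay_rate4 (theta s : R) : 0 < theta < 1 -> 0 < s < 1 ->
  Num.max theta s <= decay_rate theta s ^+ 4.
Proof.
move=> t01 s01; have g01 := decay_rate_bounds t01 s01.
have -> : Num.max theta s = 1 - 4 * (1 - decay_rate theta s).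
  by rewrite /decay_rate; field.
set y := decay_rate theta s in g01 *.
have -> : y ^+ 4 = 1 - 4 * (1 - y) + (1 - y) ^+ 2 * (y ^+ 2 + 2 * y + 3) by ring.
rewrite lerDl mulr_ge0 ?sqr_ge0//.
have := sqr_ge0 y; move: g01; lra.
Qed.

Lemma mixing_decay (theta : R) : 0 < theta < 1 ->
  exists C : R, forall f g : X -> R, holder theta f -> holder theta g ->
    forall n, `|correlation mu f g n| <=
      C * holder_norm theta f * holder_norm theta g * decay_rate theta r ^+ n.
Proof.
move=> t01; have g01 := decay_rate_bounds t01 r01.
have max4 := le_decay_rate4 t01 r01.
set y := decay_rate theta r in g01 max4 *; set m := Num.max theta r in max4.
have /andP[t0 t1] := t01; have /andP[r0 r1] := r01; have /andP[y0 y1] := g01.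
exists ((2 + D) / y ^+ 3) => f g hf hg n.
pose k := (n %/ 4)%N.
have kn : (k * 4 <= n)%N by rewrite /k leq_trunc_div.
have nk : (n <= 3 + k * 4)%N.
  by rewrite {1}(divn_eq n 4) -/k addnC leq_add2r -ltnS ltn_pmod.
have k2n : (k.*2 <= n)%N by clear -kn; lia.
have kk : (k <= n - k.*2)%N by clear -kn; lia.
set F := holder_norm theta f; set G := holder_norm theta g.
have Sf := sup_norm_ge0 hf; have Hf := holder_seminorm_ge0 hf.
have Sg := sup_norm_ge0 hg; have Hg := holder_seminorm_ge0 hg.
have F0 : 0 <= F by rewrite addr_ge0.
have G0 : 0 <= G by rewrite addr_ge0.
have m0 : 0 <= m by rewrite le_max ltW.
have tm : theta ^+ k <= m ^+ k by rewrite lerXn2r ?nnegrE ?(ltW t0)// le_max lexx.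
have rm : r ^+ (n - k.*2) <= m ^+ k.
  apply: (@le_trans _ _ (r ^+ k)); last by rewrite lerXn2r ?nnegrE ?(ltW r0)// le_max lexx orbT.
  by apply: ler_wiXn2l; rewrite ?(ltW r0) ?(ltW r1).
have my : m ^+ k <= (y ^+ 3)^-1 * y ^+ n.
  apply: (@le_trans _ _ (y ^+ (k * 4))).
    by rewrite mulnC exprM lerXn2r ?nnegrE ?exprn_ge0 ?(ltW y0).
  rewrite ler_pdivlMl ?exprn_gt0// -exprD.
  by apply: ler_wiXn2l; rewrite ?(ltW y0) ?(ltW y1).
have tf x : `|truncate f k x| <= sup_norm f by exact: (le_sup_norm hf).
have tg x : `|truncate g k x| <= sup_norm g by exact: (le_sup_norm hg).
have bf := continuous_bounded_mfun hf.1; have bg := continuous_bounded_mfun hg.1.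
have bf' := window_fun_bounded (@truncate_window f k).
have bg' := window_fun_bounded (@truncate_window g k).
have P := correlation_perturb n bf bf' bg bg' tf (le_sup_norm hg)
  (truncate_error t01 hf k) (truncate_error t01 hg k).
have W := window_correlation (@truncate_window f k) (@truncate_window g k) k2n tf tg.
have FG : holder_seminorm theta f * sup_norm g + sup_norm f * holder_seminorm theta g <= F * G.
  rewrite /F /G /holder_norm -subr_ge0.
  have -> : (sup_norm f + holder_seminorm theta f) * (sup_norm g + holder_seminorm theta g) -
    (holder_seminorm theta f * sup_norm g + sup_norm f * holder_seminorm theta g) =
    sup_norm f * sup_norm g + holder_seminorm theta f * holder_seminorm theta g by ring.
  by rewrite addr_ge0// mulr_ge0.
have SS : sup_norm f * sup_norm g <= F * G.
  by rewrite ler_pM// /F /G /holder_norm lerDl.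
rewrite -[correlation _ _ _ _](subrK (correlation mu (truncate f k) (truncate g k) n)).
apply: (le_trans (ler_normD _ _)); apply: (le_trans (lerD P W)).
have -> : (2 + D) / y ^+ 3 * F * G * y ^+ n = (2 + D) * (F * G) * ((y ^+ 3)^-1 * y ^+ n) by ring.
apply: (@le_trans _ _ ((2 + D) * (F * G) * m ^+ k)); last first.
  by rewrite ler_wpM2l// !mulr_ge0// addr_ge0.
have -> : (2 + D) * (F * G) * m ^+ k = 2 * (F * G * m ^+ k) + D * m ^+ k * (F * G) by ring.
apply: lerD.
  rewrite ler_wpM2l//.
  apply: (@le_trans _ _ (F * G * theta ^+ k)); last by rewrite ler_wpM2l// mulr_ge0.
  have -> : holder_seminorm theta f * theta ^+ k * sup_norm g +
    sup_norm f * (holder_seminorm theta g * theta ^+ k) =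
    (holder_seminorm theta f * sup_norm g + sup_norm f * holder_seminorm theta g) * theta ^+ k.
    by ring.
  by rewrite ler_wpM2r// exprn_ge0// ltW.
rewrite -[leLHS]mulrA; apply: ler_pM => //.
- by rewrite mulr_ge0// exprn_ge0// ltW.
- exact: mulr_ge0.
- by rewrite ler_wpM2l.
Qed.

End Mixing.

(** * A Toeplitz sum *)

Section ToeplitzSum.
Context {R : realType}.
Variables (c : nat -> R) (L : R).
Hypotheses (cL : forall m, \sum_(n < m) c n <= L) (c0 : 0 <= c 0).

(** The last row and column of the symmetric matrix with entries [c |i - j|] add
    up to two partial sums of [c] minus [c 0]. In truncated subtraction
    [(i - j) + (j - i)] is [|i - j|]. *)
Lemma toeplitz_sum N :
  \sum_(i < N) \sum_(j < N) c ((i - j) + (j - i))%N <= 2 * L * N%:R.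
Proof.
elim: N => [|N ih]; first by rewrite big_ord0 mulr0.
have tail : \sum_(i < N) c (N - i)%N = \sum_(n < N.+1) c n - c 0.
  rewrite big_ord_recl addrAC subrr add0r (reindex_inj rev_ord_inj) /=.
  by apply: eq_bigr => i _; congr c; rewrite /bump /=; have := ltn_ord i; lia.
rewrite big_ord_recr /=.
under eq_bigr do rewrite big_ord_recr /=.
rewrite big_split /= big_ord_recr /= !subnn addn0.
have -> : \sum_(i < N) c ((i - N) + (N - i))%N = \sum_(i < N) c (N - i)%N.
  by apply: eq_bigr => i _; congr c; have := ltn_ord i; lia.
have -> : \sum_(i < N) c ((N - i) + (i - N))%N = \sum_(i < N) c (N - i)%N.
  by apply: eq_bigr => i _; congr c; have := ltn_ord i; lia.
rewrite tail; have := cL N.+1; rewrite -natr1; move: ih c0; lra.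
Qed.

End ToeplitzSum.

(** * Words, matrix products and pressure *)

Section WordProduct.
Context {R : realType} {M d : nat}.
Local Notation I := 'I_M.+1.
Variable B : I -> 'M[R]_d.

Definition word_prod (w : seq I) : 'M[R]_d := \prod_(i <- w) B i.

Lemma word_prod_cat v w : word_prod (v ++ w) = word_prod v *m word_prod w.
Proof. by rewrite /word_prod big_cat. Qed.

Lemma word_prod_cons i w : word_prod (i :: w) = B i *m word_prod w.
Proof. by rewrite /word_prod big_cons. Qed.

Lemma sum_word_prod n : \sum_(w <- words M n) word_prod w = (\sum_i B i) ^+ n.
Proof.
elim: n => [|n ih]; first by rewrite sum_words0 /word_prod big_nil expr0.
rewrite sum_words_cons exprS -mulmxE -ih mulmx_suml; apply: eq_bigr => i _.
by rewrite mulmx_sumr; apply: eq_bigr => w _; rewrite word_prod_cons.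
Qed.

Lemma word_prod_nonneg (K : set 'cV[R]_d) w : (forall i, cone_nonneg K (B i)) ->
  cone_nonneg K (word_prod w).
Proof.
move=> KB; elim: w => [|i w ih]; first by rewrite /word_prod big_nil => v; rewrite mul1mx.
by rewrite word_prod_cons; exact: cone_nonnegM.
Qed.

End WordProduct.

Lemma word_prodZ {R : realType} {M d : nat} (B : 'I_M.+1 -> 'M[R]_d) (l : R) w :
  word_prod (fun i => l *: B i) w = l ^+ size w *: word_prod B w.
Proof.
elim: w => [|i w ih]; first by rewrite /word_prod !big_nil scale1r.
by rewrite !word_prod_cons ih -scalemxAl -scalemxAr scalerA exprS.
Qed.

Section Pressure.
Context {R : realType} {M d : nat} (A : 'I_M.+1 -> 'M[R]_d).
Local Notation X := (fullshift M).
Implicit Types (mu nu : probability X R).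

Lemma word_prod_block (x : X) n :
  word_prod A (block x 0 n) = \prod_(i < n) A (x i%:Z).
Proof.
rewrite /word_prod /block /mkseq big_map -(big_mkord xpredT (fun i => A (x i%:Z))).
by rewrite /index_iota subn0; apply: eq_bigr => i _; rewrite add0r.
Qed.

Lemma block_onto n w : size w = n -> exists x : X, block x 0 n = w.
Proof.
move=> <-; exists (extend 0 w); apply: (@eq_from_nth _ ord0); rewrite ?size_block// => k kn.
by rewrite nth_mkseq// /extend /offset !addr0 add0r absz_nat.
Qed.

Lemma cyl_mass mu a n : \sum_(w <- words M n) fine (mu (cyl a w)) = 1.
Proof.
have muf : (mu setT < +oo)%E by rewrite probability_setT ltry.
rewrite -[RHS]/(fine 1%:E) -(probability_setT mu) (measure_cyl_split muf a n)//.
by apply: eq_bigr => w _; rewrite setTI.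
Qed.

Lemma gibbs_word mu P : gibbs_with_pressure A mu P ->
  exists2 C : R, 0 < C & forall n w, size w = n -> (0 < n)%N ->
    C^-1 * fine (mu (cyl 0 w)) <= expR (- (n%:R * P)) * `|word_prod A w| /\
    expR (- (n%:R * P)) * `|word_prod A w| <= C * fine (mu (cyl 0 w)).
Proof.
move=> [_ [C [C0 G]]]; exists C => // n w wn n0.
have [x xw] := block_onto wn.
by have := G x n n0; rewrite cylinder_cyl -word_prod_block xw.
Qed.

(** Both masses of a word are comparable to the same norm, up to the exponential
    factors of the two pressures. *)
Lemma gibbs_compare mu nu P P' : gibbs_with_pressure A mu P ->
  gibbs_with_pressure A nu P' -> exists2 C : R, 0 < C &
  forall n w, size w = n -> (0 < n)%N ->
    fine (nu (cyl 0 w)) <= C * expR (n%:R * (P - P')) * fine (mu (cyl 0 w)).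
Proof.
move=> /gibbs_word[C C0 G] /gibbs_word[C' C0' G']; exists (C' * C); first exact: mulr_gt0.
move=> n w wn n0; have [_ g2] := G n w wn n0; have [g1 _] := G' n w wn n0.
rewrite ler_pdivrMl// in g1; apply: (le_trans g1).
rewrite -!mulrA ler_wpM2l ?(ltW C0')//.
have -> : expR (- (n%:R * P')) = expR (n%:R * (P - P')) * expR (- (n%:R * P)).
  by rewrite -expRD; congr expR; ring.
by rewrite -mulrA [leRHS]mulrCA ler_wpM2l ?expR_ge0.
Qed.

(** Summing the comparison over the words of length [n] leaves
    [1 <= C * exp (n (P - P'))] for every [n]. *)
Lemma gibbs_pressure_le mu nu P P' : gibbs_with_pressure A mu P ->
  gibbs_with_pressure A nu P' -> P' <= P.
Proof.
move=> G G'; have [C C0 cmp] := gibbs_compare G G'.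
have h n : expR (P' - P) ^+ n <= Num.max 1 C.
  case: n => [|n]; first by rewrite expr0 le_max lexx.
  have : \sum_(w <- words M n.+1) fine (nu (cyl 0 w)) <=
      \sum_(w <- words M n.+1) C * expR (n.+1%:R * (P - P')) * fine (mu (cyl 0 w)).
    rewrite big_seq [leRHS]big_seq; apply: ler_sum => w /size_words wn.
    exact: cmp wn (ltn0Sn n).
  rewrite -mulr_sumr !cyl_mass mulr1.
  rewrite -expRM_natl -ler_pdivrMr ?expR_gt0// mul1r -expRN le_max => e.
  apply/orP; right; apply: le_trans e; rewrite le_eqVlt; apply/orP; left.
  by apply/eqP; congr expR; ring.
have := geometric_bounded h.
by rewrite -[X in _ <= X]expR0 ler_expR subr_le0.
Qed.

Lemma gibbs_pressure_unique mu nu P P' : gibbs_with_pressure A mu P ->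
  gibbs_with_pressure A nu P' -> P = P'.
Proof.
by move=> G G'; apply/eqP; rewrite eq_le (gibbs_pressure_le G' G) (gibbs_pressure_le G G').
Qed.

(** Gibbs measures have the same pressure, so their cylinder masses are
    comparable. *)
Lemma gibbs_dominated mu nu P P' : gibbs_with_pressure A mu P ->
  gibbs_with_pressure A nu P' -> exists2 C : R, 0 <= C &
  forall a w, fine (nu (cyl a w)) <= C * fine (mu (cyl a w)).
Proof.
move=> G G'; have PP := gibbs_pressure_unique G G'.
have [C C0 cmp] := gibbs_compare G G'.
exists (Num.max 1 C); first by rewrite le_max ler01.
have inv (k : probability X R) a w : shift_invariant k ->
    fine (k (cyl a w)) = fine (k (cyl 0 w)) by move=> kS; rewrite cyl_invariant.
move=> a w; rewrite (inv nu a w G'.1) (inv mu a w G.1).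
case: w => [|i w].
  have mass1 (k : probability X R) : fine (k (cyl 0 [::])) = 1.
    by rewrite cyl_nil probability_setT.
  by rewrite !mass1 mulr1 le_max lexx.
apply: (le_trans (cmp _ (i :: w) erefl isT)); rewrite PP subrr mulr0 expR0 mulr1.
by rewrite ler_wpM2r ?fine_ge0// le_max lexx orbT.
Qed.

End Pressure.

(** * The measure built from the eigenvectors *)

Section MatrixMeasure.
Context {R : realType} {M d : nat} (A : 'I_M.+1 -> 'M[R]_d) (K : set 'cV[R]_d).
Local Notation I := 'I_M.+1.
Local Notation X := (fullshift M).
Variables (rho C : R) (u : 'rV[R]_d) (h : 'cV[R]_d).
Let B (i : I) := rho^-1 *: A i.
Let Bs := rho^-1 *: \sum_i A i.
Let W := word_prod B.
Hypotheses (rho_gt0 : 0 < rho) (C_gt0 : 0 < C).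
Hypotheses (KB : forall i, cone_nonneg K (B i)).
Hypotheses (Bh : Bs *m h = h) (uB : u *m Bs = u) (uh : u *m h = 1).
Hypothesis bounds : forall Y, cone_nonneg K Y ->
  [/\ `|Y| <= C * (u *m Y *m h) 0 0, `|u *m Y| <= C * (u *m Y *m h) 0 0 &
      `|Y *m h| <= C * (u *m Y *m h) 0 0].

Let p (w : seq I) : R := (u *m W w *m h) 0 0.

Let sumB : \sum_i B i = Bs. Proof. by rewrite -scaler_sumr. Qed.

Let KW w : cone_nonneg K (W w). Proof. exact: word_prod_nonneg. Qed.

Let p_ge0 w : 0 <= p w.
Proof.
have [b _ _] := bounds (KW w).
by rewrite -(pmulr_rge0 _ C_gt0) (le_trans _ b).
Qed.

Let p_nil : p [::] = 1.
Proof. by rewrite /p /W /word_prod big_nil mulmx1 uh mxE. Qed.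

Let p_cons w : \sum_i p (i :: w) = p w.
Proof.
rewrite -summxE -mulmx_suml; congr ((_ *m _) 0 0).
rewrite (eq_bigr (fun i => u *m B i *m W w)).
  by rewrite -mulmx_suml -mulmx_sumr sumB uB.
by move=> i _; rewrite /W word_prod_cons mulmxA.
Qed.

Let p_rcons w : \sum_i p (rcons w i) = p w.
Proof.
rewrite -summxE (eq_bigr (fun i => u *m W w *m (B i *m h))).
  by rewrite -mulmx_sumr -mulmx_suml sumB Bh.
move=> i _; rewrite /W -cats1 word_prod_cat word_prod_cons.
by rewrite {2}/word_prod big_nil mulmx1 !mulmxA.
Qed.

Lemma matrix_measure_exists : exists mu : probability X R,
  forall a w, fine (mu (cyl a w)) = p w.
Proof.
have [mu muE] := word_measure p_ge0 p_nil p_cons p_rcons.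
by exists mu => a w; rewrite muE.
Qed.

Variable mu : probability X R.
Hypothesis muE : forall a w, fine (mu (cyl a w)) = p w.

Let mu_fin : (mu setT < +oo)%E. Proof. by rewrite probability_setT ltry. Qed.

Lemma matrix_measure_invariant : shift_invariant mu.
Proof. by apply: shift_invariant_cyl => a w; rewrite !muE. Qed.

(** Summing over the words filling a gap replaces the product of the letters
    in the gap by a power of the sum of the matrices. *)
Lemma matrix_measure_gap a v g w :
  fine (mu (cyl a v `&` cyl (a + (size v)%:Z + g%:Z) w)) =
  (u *m W v *m Bs ^+ g *m (W w *m h)) 0 0.
Proof.
rewrite (measure_cyl_split mu_fin (a + (size v)%:Z) g); last first.
  by apply: measurableI; exact: measurable_cyl.
transitivity (\sum_(z <- words M g) p (v ++ (z ++ w))).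
  rewrite big_seq [RHS]big_seq; apply: eq_bigr => z /size_words zg.
  by rewrite -(muE a) !cyl_cat zg -setIA [X in _ `&` X]setIC.
rewrite -summxE; congr (_ 0 0).
rewrite (eq_bigr (fun z => u *m W v *m W z *m (W w *m h))).
  by rewrite -mulmx_suml -mulmx_sumr sum_word_prod sumB.
by move=> z _; rewrite /W !word_prod_cat !mulmxA.
Qed.

Lemma matrix_measure_gap_error a v g w :
  fine (mu (cyl a v `&` cyl (a + (size v)%:Z + g%:Z) w)) - p v * p w =
  (u *m W v *m (Bs ^+ g - h *m u) *m (W w *m h)) 0 0.
Proof.
rewrite matrix_measure_gap mulmxBr mulmxBl [RHS]mxE; congr (_ + _).
have -> : u *m W v *m (h *m u) *m (W w *m h) = (u *m W v *m h) *m (u *m W w *m h).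
  by rewrite !mulmxA.
by rewrite [RHS]mxE; congr (- _); rewrite [RHS]mxE big_ord1.
Qed.

(** Norms next to the words turn back into weights by [bounds]. *)
Lemma matrix_entry_bound v w (Y : 'M[R]_d) :
  `|(u *m W v *m Y *m (W w *m h)) 0 0| <= d%:R * (d%:R * (C * C) * `|Y|) * (p v * p w).
Proof.
have [_ bu _] := bounds (KW v); have [_ _ bh] := bounds (KW w).
rewrite (le_trans (entry_le_norm _ _ _))// (le_trans (norm_mulmx _ _))//.
rewrite -!mulrA ler_wpM2l//.
apply: (@le_trans _ _ (d%:R * `|u *m W v| * `|Y| * (C * p w))).
  by rewrite ler_pM// norm_mulmx.
have -> : d%:R * (C * (C * (`|Y| * (p v * p w)))) =
  d%:R * (C * p v) * `|Y| * (C * p w) by ring.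
by do 2!(rewrite ler_wpM2r ?mulr_ge0 ?(ltW C_gt0)//); rewrite ler_wpM2l.
Qed.

Lemma matrix_measure_mixing (D r : R) : 0 <= D ->
  (forall n, `|Bs ^+ n - h *m u| <= D * r ^+ n) ->
  forall a v g w,
  `|fine (mu (cyl a v `&` cyl (a + (size v)%:Z + g%:Z) w)) -
    fine (mu (cyl a v)) * fine (mu (cyl (a + (size v)%:Z + g%:Z) w))| <=
  (d%:R * (d%:R * (C * C) * D)) * r ^+ g *
    (fine (mu (cyl a v)) * fine (mu (cyl (a + (size v)%:Z + g%:Z) w))).
Proof.
move=> D0 BD a v g w; rewrite !(muE, matrix_measure_gap_error) (le_trans (matrix_entry_bound _ _ _))//.
rewrite ler_wpM2r ?mulr_ge0// -!mulrA !ler_wpM2l// ?(ltW C_gt0)//.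
Qed.

(** Correlations at overlapping positions are at most 1 and there are boundedly
    many of them; beyond the length of [w] they are matrix coefficients of
    [Bs ^ i - h u], whose sums stay bounded. *)
Lemma matrix_measure_correlations (C' : R) :
  (forall n, `|\sum_(i < n) (Bs ^+ i - h *m u)| <= C') ->
  forall w, exists L : R, forall N, \sum_(i < N) \sum_(j < N)
  (fine (mu (cyl i%:Z w `&` cyl j%:Z w)) - fine (mu (cyl 0 w)) ^+ 2) <= L * N%:R.
Proof.
move=> EC w.
have mC a : measurable (cyl a w) by exact: measurable_cyl.
have mCI a b : measurable (cyl a w `&` cyl b w) by exact: measurableI.
have muS := matrix_measure_invariant.
pose c n := fine (mu (cyl 0 w `&` cyl n%:Z w)) - p w ^+ 2.
have muI i n : fine (mu (cyl i%:Z w `&` cyl (i%:Z + n%:Z) w)) - p w ^+ 2 = c n.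
  congr (fine _ - _); elim: i => [|i ih]; first by rewrite add0r.
  rewrite -ih -[RHS]muS// preimage_setI !cyl_shift1.
  have -> : i.+1%:Z + n%:Z = i%:Z + n%:Z + 1 by clear; lia.
  by have -> : i.+1%:Z = i%:Z + 1 by clear; lia.
have p01 : p w <= 1.
  by rewrite -(muE 0) -lee_fin -fin_measure// probability_le1.
have c_le1 n : c n <= 1.
  rewrite /c lerBlDr (@le_trans _ _ 1)//; last by rewrite lerDl sqr_ge0.
  by rewrite -lee_fin -fin_measure// probability_le1.
have c0 : 0 <= c 0%N.
  rewrite /c setIid muE expr2 -{1}[p w]mulr1 -mulrBr mulr_ge0// subr_ge0//.
pose L := (size w)%:R + d%:R * (d%:R * (C * C) * C') * (p w * p w).
have C'0 : 0 <= C' := le_trans (normr_ge0 _) (EC 0%N).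
have L0 : 0 <= d%:R * (d%:R * (C * C) * C') * (p w * p w).
  by rewrite !mulr_ge0// ltW.
have cL m : \sum_(n < m) c n <= L.
  have head k : \sum_(n < k) c n <= k%:R.
    by rewrite -[k in k%:R]card_ord -sumr_const ler_sum// => n _; exact: c_le1.
  have [mw|/ltnW wm] := leqP m (size w).
    rewrite (le_trans (head m))// /L (@le_trans _ _ (size w)%:R) ?ler_nat//.
    by rewrite lerDl.
  rewrite -(subnKC wm) big_split_ord /= lerD//; first exact: head.
  set k := (m - size w)%N.
  have -> : \sum_(i < k) c (size w + i)%N =
      (u *m W w *m (\sum_(i < k) (Bs ^+ i - h *m u)) *m (W w *m h)) 0 0.
    rewrite mulmx_sumr mulmx_suml summxE; apply: eq_bigr => i _.
    by rewrite -(matrix_measure_gap_error 0) /c expr2 add0r PoszD.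
  rewrite (le_trans (ler_norm _))// (le_trans (matrix_entry_bound _ _ _))//.
  rewrite ler_wpM2r ?mulr_ge0// !ler_wpM2l// ?mulr_ge0//; exact: ltW.
exists (2 * L) => N; apply: le_trans (toeplitz_sum cL c0 N).
rewrite le_eqVlt; apply/orP; left; apply/eqP.
apply: eq_bigr => i _; apply: eq_bigr => j _; rewrite muE.
have [ij|/ltnW ji] := leqP i j.
  have -> : (i - j = 0)%N by apply/eqP.
  by rewrite add0n -(muI i) -PoszD subnKC.
have -> : (j - i = 0)%N by apply/eqP.
by rewrite addn0 -(muI j) -PoszD subnKC// setIC.
Qed.

(** Multiplying the letters by [1 / rho] accounts for the pressure [ln rho]. *)
Lemma matrix_measure_gibbs : gibbs_with_pressure A mu (ln rho).
Proof.
split; first exact: matrix_measure_invariant.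
pose C' := C + d%:R * (d%:R * `|u|) * `|h| + 1.
have e0 : 0 <= d%:R * (d%:R * `|u|) * `|h| by rewrite !mulr_ge0.
have C'0 : 0 < C' by rewrite /C'; have := ltW C_gt0; lra.
exists C'; split=> // x n n0; rewrite cylinder_cyl muE -(word_prod_block A x n).
set w := block x 0 n.
have -> : expR (- (n%:R * ln rho)) * `|word_prod A w| = `|W w|.
  rewrite /W word_prodZ size_block normrZ normrX ger0_norm ?invr_ge0 ?(ltW rho_gt0)//.
  by rewrite expRN expRM_natl lnK ?posrE// exprVn.
have [b _ _] := bounds (KW w); have p0 : 0 <= (u *m W w *m h) 0 0 := p_ge0 w.
split; last first.
  by rewrite (le_trans b)// ler_wpM2r// /C'; lra.
rewrite ler_pdivrMl// (@le_trans _ _ (d%:R * (d%:R * `|u|) * `|h| * `|W w|))//.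
  rewrite (le_trans (ler_norm _))// (le_trans (entry_le_norm _ _ _))//.
  rewrite (le_trans (norm_mulmx _ _))// [leRHS]mulrAC ler_wpM2r//.
  by rewrite -[leRHS]mulrA ler_wpM2l// norm_mulmx.
by rewrite ler_wpM2r// /C'; have := ltW C_gt0; lra.
Qed.

End MatrixMeasure.

Theorem theorem2p4 (R : realType) :
  exists gamma : R -> set R[i] -> R,
  forall (M d : nat) (A : 'I_M.+1 -> 'M[R]_d) (K : set 'cV[R]_d),
    is_cone K -> closed K -> K <> [set 0] ->
    (forall i, cone_nonneg K (A i)) ->
    cone_irreducible K (\sum_i A i) ->
    \sum_i A i != 0 ->
  exists mu : probability (fullshift M) R,
    [/\ gibbs A mu,
        ergodic mu,
        (forall nu : probability (fullshift M) R, gibbs A nu ->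
           forall B, measurable B -> nu B = mu B),
        (forall P : R, gibbs_with_pressure A mu P <->
           P = ln (spectral_radius (\sum_i A i))) &
        cone_primitive K (\sum_i A i) ->
          weak_bernoulli mu /\
          forall theta : R, 0 < theta < 1 ->
            0 < gamma theta (spectrum (\sum_i A i)) < 1 /\
            exists D : R, forall f g : fullshift M -> R,
              holder theta f -> holder theta g ->
              forall n : nat,
                `|correlation mu f g n| <=
                  D * holder_norm theta f * holder_norm theta g *
                  gamma theta (spectrum (\sum_i A i)) ^+ n].
Proof.
exists (fun theta S => decay_rate theta (mixing_rate S)).
move=> M d A K coneK closedK K0 KA irrA A0.
have Ksum : cone_nonneg K (\sum_i A i).
  by move=> v Kv; rewrite mulmx_suml; apply: cone_sum => // i _; exact: KA.
have [u [h [C /= [[rho0 C0] [Bh uB uh] bounds EC prim]]]] :=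
  perron_frobenius coneK closedK K0 Ksum irrA A0.
set rho := spectral_radius _ in rho0 *.
have KB i : cone_nonneg K (rho^-1 *: A i).
  by apply: cone_nonnegZ => //; rewrite invr_ge0 ltW.
have [mu muE] := matrix_measure_exists C0 KB Bh uB uh bounds.
have G := matrix_measure_gibbs rho0 C0 KB bounds muE.
have muS := G.1.
have cor := matrix_measure_correlations C0 KB bounds muE EC.
have muF (k : probability (fullshift M) R) : (k setT < +oo)%E.
  by rewrite probability_setT ltry.
exists mu; split.
- by exists (ln rho).
- exact: invariant_trivial muS cor.
- move=> nu [P Gnu] B mB; have [C1 C10 dom] := gibbs_dominated G Gnu.
  rewrite (fin_measure (muF nu) mB) (fin_measure (muF mu) mB); congr (_%:E).
  rewrite (dominated_proportional muS cor (muF nu) Gnu.1 C10 dom mB).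
  have nuT : fine (nu setT) = 1 by rewrite probability_setT.
  by rewrite -[RHS]mulr1; congr (_ * _).
- by move=> P; split=> [GP|->//]; exact: gibbs_pressure_unique GP G.
move=> /prim[r01 [D D0 BD]].
have mix := matrix_measure_mixing C0 KB bounds muE D0 BD.
have D'0 : 0 <= d%:R * (d%:R * (C * C) * D) by rewrite !mulr_ge0// ltW.
split; first exact: mixing_weak_bernoulli D'0 r01 mix.
move=> theta t01; split; first exact: decay_rate_bounds.
exact: mixing_decay muS _ _ D'0 r01 mix _ t01.
Qed.
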